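(* Let $m\ge 1$, $1\le p<\infty$, and let $U\subset F_B(\mathbb{R}^m)$. Let $\overline{U}$ denote the closure of $U$ in $(F_B(\mathbb{R}^m)^p,d_p)$. Then $U$ is compact in $(F_B(\mathbb{R}^m), d_p)$ if and only if (i) $U$ is uniformly $p$-mean bounded; (ii) $U$ is $p$-mean equi-left-continuous; and (iii) $\overline{U}=U$.
   Context: $H$ is the Hausdorff metric on nonempty closed subsets of $\mathbb{R}^m$ (Euclidean distance): $H(A,B)=\max\{\sup_{a\in A}\inf_{b\in B}d(a,b),\ \sup_{b\in B}\inf_{a\in A}d(a,b)\}$ (possibly $+\infty$). A fuzzy set on $\mathbb{R}^m$ is a function $u:\mathbb{R}^m\to[0,1]$; its cuts are $[u]_\alpha=\{x: u(x)\ge\alpha\}$ for $\alpha\in(0,1]$ and $[u]_0=\overline{\{x: u(x)>0\}}$. $F_B(\mathbb{R}^m)$ is the set of fuzzy sets $u$ on $\mathbb{R}^m$ that are normal ($u(x_0)=1$ for some $x_0$), upper semi-continuous, and have $[u]_0$ bounded. $F_B(\mathbb{R}^m)^p\supset F_B(\mathbb{R}^m)$ is the set of normal upper semi-continuous fuzzy sets $u$ with $\left(\int_0^1 H([u]_\alpha,\{0\})^p\,d\alpha\right)^{1/p}<+\infty$, where $0$ is the origin. The metric on both is $d_p(u,v)=\left(\int_0^1 H([u]_\alpha,[v]_\alpha)^p\,d\alpha\right)^{1/p}$. A set $U\subset F_B(\mathbb{R}^m)^p$ is uniformly $p$-mean bounded if there is $M>0$ with $d_p(u,\widehat{0})\le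 M$ for all $u\in U$, where $\widehat 0$ is the characteristic function of $\{0\}$. $U$ is $p$-mean equi-left-continuous if for every $\varepsilon>0$ there is $\delta>0$ such that for all $0\le h<\delta$ and all $u\in U$, $\left(\int_h^1 H([u]_\alpha,[u]_{\alpha-h})^p\,d\alpha\right)^{1/p}<\varepsilon$. *)

(* Defs.v *)
(* Built on MathComp-Analysis. *)
From HB Require Import structures.
From mathcomp Require Import all_boot all_order all_algebra.
From mathcomp Require Import all_classical all_reals all_analysis.

Set Implicit Arguments.
Unset Strict Implicit.
Unset Printing Implicit Defensive.

Import Order.TTheory GRing.Theory Num.Theory.
Import numFieldNormedType.Exports.

Local Open Scope classical_set_scope.
Local Open Scope ring_scope.

(* The library norm on 'rV[R]_m is the sup norm. The topology and the bounded
   sets it gives are the usual (Euclidean) ones, so the library notions are used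
   for these, but distances are computed with the following function. *)
Definition edist (R : realType) (m : nat) (x y : 'rV[R]_m) : R :=
  Num.sqrt (\sum_(i < m) (x 0 i - y 0 i) ^+ 2).

Definition hausdorff_dist (R : realType) (m : nat) (A B : set 'rV[R]_m) : \bar R :=
  maxe
    (ereal_sup [set ereal_inf [set (edist a b)%:E | b in B] | a in A])
    (ereal_sup [set ereal_inf [set (edist a b)%:E | a in A] | b in B]).

Definition fuzzy (R : realType) (m : nat) (u : 'rV[R]_m -> R) : Prop :=
  forall x, 0 <= u x <= 1.

(* Only levels in [0, 1] are meaningful. *)
Definition fcut (R : realType) (m : nat) (u : 'rV[R]_m -> R) (alpha : R) :
    set 'rV[R]_m :=
  if alpha == 0 then closure [set x | 0 < u x] else [set x | alpha <= u x].

Definition normal (R : realType) (m : nat) (u : 'rV[R]_m -> R) : Prop :=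
  exists x, u x = 1.

Definition upper_semicontinuous (R : realType) (m : nat) (u : 'rV[R]_m -> R) :
    Prop :=
  forall x a, u x < a -> \forall y \near x, u y < a.

(* The integrals below are integrals of nonnegative extended real functions,
   so dp is always defined, possibly with value +oo. *)
Definition dp (R : realType) (m : nat) (p : R) (u v : 'rV[R]_m -> R) : \bar R :=
  ((\int[lebesgue_measure]_(alpha in `[0%R, 1%R])
      (hausdorff_dist (fcut u alpha) (fcut v alpha) `^ p)) `^ p^-1)%E.

Definition FB (R : realType) (m : nat) : set ('rV[R]_m -> R) :=
  [set u | [/\ fuzzy u, normal u, upper_semicontinuous u &
               bounded_set (fcut u 0)]].

Definition FBp (R : realType) (m : nat) (p : R) : set ('rV[R]_m -> R) :=
  [set u | [/\ fuzzy u, normal u, upper_semicontinuous u &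
     ((\int[lebesgue_measure]_(alpha in `[0%R, 1%R])
         (hausdorff_dist (fcut u alpha) [set 0%R] `^ p)) `^ p^-1 < +oo)%E]].

Definition hat0 (R : realType) (m : nat) : 'rV[R]_m -> R := \1_[set 0].

Definition unif_p_mean_bounded (R : realType) (m : nat) (p : R)
    (U : set ('rV[R]_m -> R)) : Prop :=
  exists2 M : R, 0 < M & forall u, U u -> (dp p u (@hat0 R m) <= M%:E)%E.

Definition p_mean_equi_left_continuous (R : realType) (m : nat) (p : R)
    (U : set ('rV[R]_m -> R)) : Prop :=
  forall eps : R, 0 < eps -> exists2 delta : R, 0 < delta &
    forall (h : R) u, 0 <= h -> h < delta -> U u ->
      ((\int[lebesgue_measure]_(alpha in `[h, 1%R])
          (hausdorff_dist (fcut u alpha) (fcut u (alpha - h)%R) `^ p)) `^ p^-1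
        < eps%:E)%E.

(* The space (X, dp), for X a set of fuzzy sets such as FB or FBp p, with the
   topology induced by dp: a set is open when it contains a ball of positive
   radius around each of its points. This construction of the topology does not
   itself depend on the metric axioms for dp. *)
Definition dp_space (R : realType) (m : nat) (p : R)
    (X : set ('rV[R]_m -> R)) : Type := {u | X u}.

Section dp_topology.
Context (R : realType) (m : nat) (p : R) (X : set ('rV[R]_m -> R)).

Definition dp_open : set_system (dp_space p X) :=
  [set A | forall u, A u -> exists2 r : R, 0 < r &
     [set v : dp_space p X | (dp p (sval u) (sval v) < r%:E)%E] `<=` A].

Lemma dp_openT : dp_open setT.
Proof. by move=> u _; exists 1. Qed.

Lemma dp_openI : setI_closed dp_open.
Proof.
move=> A B oA oB u [/oA[r r0 rA] /oB[s s0 sB]].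
exists (Num.min r s); first by rewrite lt_min r0 s0.
move=> v /= duv; split; [apply: rA | apply: sB];
  by apply: (lt_le_trans duv); rewrite lee_fin ge_min lexx ?orbT.
Qed.

Lemma dp_open_bigcup (I : Type) (f : I -> set (dp_space p X)) :
  (forall i, dp_open (f i)) -> dp_open (\bigcup_i f i).
Proof.
move=> of_ u [i _ /of_ [r r0 rf]]; exists r => // v /rf fv.
by exists i.
Qed.

HB.instance Definition _ := gen_eqMixin (dp_space p X).
HB.instance Definition _ := gen_choiceMixin (dp_space p X).
HB.instance Definition _ := isOpenTopological.Build (dp_space p X)
  dp_openT dp_openI dp_open_bigcup.

End dp_topology.

(* The subset of (X, dp) formed by the members of X that belong to U. *)
Definition in_dp_space (R : realType) (m : nat) (p : R)
    (X U : set ('rV[R]_m -> R)) : set (dp_space p X) :=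
  [set u | U (sval u)].
Arguments in_dp_space {R m} p X U.

(* Main.v *)
(* If [U] is compact, finite nets transfer to [U] the boundedness and the
   left-continuity of each single element, and [U] is closed because [dp] is a
   metric. Conversely, let [F] be an ultrafilter on [U]. Equi-left-continuity
   lets one replace the cuts of [u] by the cuts at finitely many levels [k h],
   and makes the contribution of the levels below [h] uniformly small; the cuts
   at level [k h] lie in one common ball, so up to a small error they take
   finitely many values, and [F] is a Cauchy filter. A fast Cauchy sequence of
   fuzzy sets has cuts that converge for almost every level; the limit sets are
   the cuts of a fuzzy set except at countably many levels, and this fuzzy set is
   the limit, which belongs to [U] as [U] is closed. *)
Require Import Defs.
From HB Require Import structures.
From mathcomp Require Import all_boot all_order all_algebra.
From mathcomp Require Import all_classical all_reals all_analysis measurable_realfun.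
From mathcomp Require Import lra ring.
Set Implicit Arguments.
Unset Strict Implicit.
Unset Printing Implicit Defensive.

Import Order.TTheory GRing.Theory Num.Theory.
Import numFieldNormedType.Exports.

Local Open Scope classical_set_scope.
Local Open Scope ring_scope.

(* The library also has an [edist], which shadows the one of [Defs]. *)
Local Notation edist := Defs.edist.

(** * Euclidean distance and Hausdorff distance *)

(** Everything about levels rests on the nestedness of cuts. Distance functions of nested sets are
    ordered, so the distance from the cut at [t] to any cut at a level between [t - h] and [t] is at
    most its distance to the cut at [t - h]; the same order makes the integrands measurable in the
    level. Three obstacles shape the proof. A p-mean bound [M] confines the cuts at level [h] only
    to radius [M / h^(1/p)], which blows up at level 0. The limit of a Cauchy sequence of [FB] need
    only lie in [FBp p], so the closure is taken there and only (iii) brings the limit back.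
    Finally, [dp] sees cuts only at almost every level, so the limit sets are lower limits, which
    stay nested even at levels where nothing converges. Consecutive gaps are at most [4^-(n+1)]:
    after multiplication by [2^n] they are still summable, and dividing by that weight gives a
    geometric rate at almost every level. *)

Section edist_theory.
Context (R : realType) (m : nat).
Implicit Types (x y z : 'rV[R]_m) (A B C : set 'rV[R]_m) (r e : R).

Lemma edist_ge0 x y : 0 <= edist x y. Proof. exact: sqrtr_ge0. Qed.

Lemma edistxx x : edist x x = 0.
Proof. by rewrite /edist big1 ?sqrtr0// => i _; rewrite subrr expr0n. Qed.

Lemma edistC x y : edist x y = edist y x.
Proof.
by congr Num.sqrt; apply: eq_bigr => i _; rewrite -sqrrN opprB.
Qed.

Lemma sumr_sqr_ge0 (a : 'I_m -> R) : 0 <= \sum_i a i ^+ 2.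
Proof. by apply: sumr_ge0 => i _; exact: sqr_ge0. Qed.

(** Summing [0 <= (t * a i - s * b i) ^+ 2], with [s] and [t] the two norms, bounds [2 * s * t]
    times the left side by [2 * (s * t) ^+ 2]. Cancelling [s * t] forces the separate treatment of
    zero norms. *)
Lemma CauchySchwarz_sum (a b : 'I_m -> R) :
  \sum_i a i * b i <=
    Num.sqrt (\sum_i a i ^+ 2) * Num.sqrt (\sum_i b i ^+ 2).
Proof.
set s := Num.sqrt (\sum_i a i ^+ 2); set t := Num.sqrt (\sum_i b i ^+ 2).
have s2 : s ^+ 2 = \sum_i a i ^+ 2 by rewrite sqr_sqrtr ?sumr_sqr_ge0.
have t2 : t ^+ 2 = \sum_i b i ^+ 2 by rewrite sqr_sqrtr ?sumr_sqr_ge0.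
have s0 : 0 <= s by exact: sqrtr_ge0.
have t0 : 0 <= t by exact: sqrtr_ge0.
have zero (c : 'I_m -> R) : \sum_i c i ^+ 2 = 0 -> forall i, c i = 0.
  move=> /eqP; rewrite psumr_eq0 => [/allP c0 i|i _]; last exact: sqr_ge0.
  by have := c0 i (mem_index_enum i); rewrite /= sqrf_eq0 => /eqP.
have [s_eq0|sN0] := eqVneq s 0.
  rewrite s_eq0 mul0r big1// => i _; rewrite (zero a) ?mul0r//.
  by rewrite -s2 s_eq0 expr0n.
have [t_eq0|tN0] := eqVneq t 0.
  rewrite t_eq0 mulr0 big1// => i _; rewrite (zero b) ?mulr0//.
  by rewrite -t2 t_eq0 expr0n.
have st : 0 < s * t by rewrite mulr_gt0// lt_neqAle eq_sym ?sN0 ?tN0.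
rewrite -(ler_pM2l st) -(@ler_pM2l _ 2)// !mulr_sumr.
have : \sum_i 2 * (s * t * (a i * b i)) <=
       \sum_i (t ^+ 2 * a i ^+ 2 + s ^+ 2 * b i ^+ 2).
  by apply: ler_sum => i _; have := sqr_ge0 (t * a i - s * b i); lra.
move/le_trans; apply; rewrite big_split/= -!mulr_sumr -s2 -t2; lra.
Qed.

Lemma edist_triangle y x z : edist x z <= edist x y + edist y z.
Proof.
rewrite -(@ler_pXn2r _ 2)// ?nnegrE ?addr_ge0 ?edist_ge0// sqr_sqrtr ?sumr_sqr_ge0//.
rewrite sqrrD !sqr_sqrtr ?sumr_sqr_ge0//.
have := CauchySchwarz_sum (fun i => x 0 i - y 0 i) (fun i => y 0 i - z 0 i).
rewrite -/(edist x y) -/(edist y z) => H.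
have -> : \sum_(i < m) (x 0 i - z 0 i) ^+ 2 =
    \sum_(i < m) (x 0 i - y 0 i) ^+ 2 +
    (\sum_(i < m) (x 0 i - y 0 i) * (y 0 i - z 0 i)) *+ 2 +
    \sum_(i < m) (y 0 i - z 0 i) ^+ 2.
  rewrite -sumrMnl -!big_split/=; apply: eq_bigr => i _.
  by rewrite mulr2n; ring.
by rewrite lerD2r lerD2l lerMn2r orbC H.
Qed.

Lemma coord_le_edist x y i : `|x 0 i - y 0 i| <= edist x y.
Proof.
rewrite -sqrtr_sqr ler_wsqrtr// (bigD1 i)//= lerDl.
by apply: sumr_ge0 => j _; exact: sqr_ge0.
Qed.

Lemma edist_le_coord x y e : 0 <= e -> (forall i, `|x 0 i - y 0 i| <= e) ->
  edist x y <= m%:R * e.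
Proof.
move=> e0 xye; rewrite -(@ger0_norm _ (m%:R * e)) ?mulr_ge0//.
rewrite -sqrtr_sqr ler_wsqrtr//.
have : \sum_(i < m) (x 0 i - y 0 i) ^+ 2 <= \sum_(i < m) e ^+ 2.
  apply: ler_sum => i _; rewrite -real_normK ?num_real//.
  by rewrite ler_pXn2r ?nnegrE.
move/le_trans; apply; rewrite sumr_const card_ord exprMn.
rewrite -[e ^+ 2 *+ m]mulr_natl ler_wpM2r ?sqr_ge0//.
by rewrite -natrX ler_nat; case: (m) => // k; rewrite leq_pmulr.
Qed.

Lemma norm_le_edist x : `|x| <= edist x 0.
Proof.
rewrite [leLHS]mx_normrE; apply/bigmax_leP; split; first exact: edist_ge0.
move=> [i j] _ /=; rewrite (ord1 i) -[X in `|X|]subr0.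
by have := coord_le_edist x 0 j; rewrite mxE.
Qed.

Lemma coord_le_norm x i : `|x 0 i| <= `|x|.
Proof.
rewrite [leRHS]mx_normrE.
by apply: (le_bigmax _ (fun ij : 'I_1 * 'I_m => `|x ij.1 ij.2|) (0, i)).
Qed.

Lemma edist_le_norm x y : edist x y <= m%:R * `|x - y|.
Proof.
apply: edist_le_coord => // i.
by have := coord_le_norm (x - y) i; rewrite !mxE.
Qed.

Lemma near_edist x e : 0 < e -> \forall y \near x, edist x y < e.
Proof.
(* The constant of [edist_le_norm] is [m]; adding 1 keeps the divisor positive for every [m]. *)
move=> e0; have m0 : 0 < m%:R + 1 :> R by rewrite ltr_wpDl.
apply/nbhs_ballP; exists (e / (m%:R + 1)); first exact: divr_gt0.
move=> y; rewrite -ball_normE/= ltr_pdivlMr// => xye.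
apply: le_lt_trans xye; apply: le_trans (edist_le_norm x y) _.
by rewrite mulrC ler_wpM2l// lerDl.
Qed.

Lemma near_edistP x (P : set 'rV[R]_m) :
  (\forall y \near x, P y) <-> exists2 e, 0 < e & forall y, edist x y < e -> P y.
Proof.
split=> [/nbhs_ballP[e /= e0 xP]|[e e0 xP]].
  exists e => // y xy; apply: xP; rewrite -ball_normE/=.
  apply: le_lt_trans xy.
  rewrite (le_trans (norm_le_edist _))// le_eqVlt; apply/orP; left; apply/eqP.
  by congr Num.sqrt; apply: eq_bigr => i _; rewrite !mxE subr0.
by near=> y; apply: xP; near: y; exact: near_edist.
Unshelve. all: by end_near. Qed.

Lemma exists_rat_edist x e : 0 < e ->
  exists q : 'rV[rat]_m, edist x (map_mx ratr q) < e.
Proof.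
move=> e0; pose d := e / (m%:R + 1).
have m0 : 0 < m%:R + 1 :> R by rewrite ltr_wpDl.
have d0 : 0 < d by exact: divr_gt0.
have /choice[q qx] : forall i, exists q : rat, `|x 0 i - ratr q| <= d.
  move=> i.
  have [q] := rat_in_itvoo (ltr_pwDr d0 (lexx (x 0 i))).
  rewrite in_itv/= => /andP[xq qd]; exists q.
  by rewrite distrC gtr0_norm ?subr_gt0// lerBlDl ltW.
exists (\row_i q i); apply: (@le_lt_trans _ _ (m%:R * d)).
  by apply: edist_le_coord => [|i]; [exact: ltW|rewrite !mxE].
rewrite /d mulrCA gtr_pMr// ltr_pdivrMr// mul1r; lra.
Qed.

Lemma bounded_set_edist A e : (forall x, A x -> edist x 0 <= e) -> bounded_set A.
Proof.
move=> Ae; exists e; split; first exact: num_real.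
move=> M eM x /Ae xe; apply: le_trans (norm_le_edist x) _.
by rewrite (le_trans xe)// ltW.
Qed.

Lemma edist_bounded_set A : bounded_set A ->
  exists2 M : R, 0 < M & forall x, A x -> edist x 0 <= M.
Proof.
case=> M [_ /(_ (`|M| + 1))].
rewrite (le_lt_trans (ler_norm M)) ?ltrDl// => /(_ isT) AM.
exists (m%:R * (`|M| + 1) + 1); first by rewrite ltr_wpDl// mulr_ge0// addr_ge0.
move=> x /AM xM; apply: (le_trans (edist_le_norm _ _)).
rewrite subr0; apply: (@le_trans _ _ (m%:R * (`|M| + 1))); last by rewrite lerDl.
exact: ler_wpM2l.
Qed.

End edist_theory.

Section distance_to_a_set.
Context (R : realType) (m : nat).
Implicit Types (x y z : 'rV[R]_m) (A B C : set 'rV[R]_m) (r e : R).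

(** Real-valued, so that differences make sense; on the empty set it takes the default value of
    [inf], hence the recurring nonemptiness assumptions. *)
Definition dset A x : R := inf [set edist x a | a in A].

Lemma dset_ge A x r : A !=set0 -> (forall a, A a -> r <= edist x a) ->
  r <= dset A x.
Proof.
move=> [a0 Aa0] rA; apply: lb_le_inf; first by exists (edist x a0), a0.
by move=> _ [a Aa <-]; exact: rA.
Qed.

Lemma dset_le A x a : A a -> dset A x <= edist x a.
Proof.
move=> Aa; apply: ge_inf; last by exists a.
by exists 0 => _ [b _ <-]; exact: edist_ge0.
Qed.

Lemma dset_ge0 A x : A !=set0 -> 0 <= dset A x.
Proof. by move/dset_ge; apply=> a _; exact: edist_ge0. Qed.

Lemma dset_adherent A x e : A !=set0 -> 0 < e ->
  exists2 a, A a & edist x a < dset A x + e.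
Proof.
move=> A0 e0; apply: contrapT => /forall2NP nA.
suff : dset A x + e <= dset A x by rewrite gerDl leNgt e0.
by apply: dset_ge => // a Aa; rewrite leNgt; apply/negP; case: (nA a).
Qed.

Lemma dset_lipschitz A x y : A !=set0 -> dset A x <= dset A y + edist x y.
Proof.
move=> A0; rewrite -lerBlDr; apply: dset_ge => // a Aa.
rewrite lerBlDl (le_trans (dset_le _ Aa))//; exact: edist_triangle.
Qed.

Lemma dset_eq0 A x : A x -> dset A x = 0.
Proof.
move=> Ax; apply/eqP; rewrite eq_le dset_ge0 ?andbT; last by exists x.
by rewrite -(edistxx x) dset_le.
Qed.

Lemma dset_anti A B x : A !=set0 -> A `<=` B -> dset B x <= dset A x.
Proof. by move=> A0 AB; apply: dset_ge => // a /AB; exact: dset_le. Qed.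

Lemma closed_dset A x : closed A -> A !=set0 -> dset A x <= 0 -> A x.
Proof.
move=> clA A0 Ax; apply: clA => B /near_edistP[e e0 xB].
have [a Aa xa] := dset_adherent x A0 e0; exists a; split => //.
by apply: xB; rewrite (lt_le_trans xa)// gerDr.
Qed.

Lemma dset_set1 x y : dset [set y] x = edist x y.
Proof. by rewrite /dset image_set1 inf1. Qed.

End distance_to_a_set.

Section hausdorff.
Context (R : realType) (m : nat).
Implicit Types (x y z : 'rV[R]_m) (A B C : set 'rV[R]_m) (r e : R).
Local Open Scope ereal_scope.

Lemma ereal_inf_edist A x : A !=set0 ->
  ereal_inf [set (edist x a)%:E | a in A] = (dset A x)%:E.
Proof.
move=> A0; rewrite -(@image_comp _ _ _ (edist x) EFin) ereal_inf_EFin//.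
- by exists 0%R => _ [a _ <-]; exact: edist_ge0.
- by case: A0 => a Aa; exists (edist x a), a.
Qed.

Lemma hausdorff_distE A B : A !=set0 -> B !=set0 -> hausdorff_dist A B =
  maxe (ereal_sup [set (dset B a)%:E | a in A])
       (ereal_sup [set (dset A b)%:E | b in B]).
Proof.
move=> A0 B0; congr maxe; congr ereal_sup; apply: eq_imagel => x _.
  exact: ereal_inf_edist.
rewrite -ereal_inf_edist//; congr ereal_inf.
by apply: eq_imagel => y _; rewrite edistC.
Qed.

(* The Hausdorff distance is the uniform distance of the distance functions;
   this makes the metric axioms immediate and reduces measurability of
   [alpha |-> H (A alpha) (B alpha)] to that of countably many functions. *)
Lemma hausdorff_leP A B (r : \bar R) : A !=set0 -> B !=set0 ->
  hausdorff_dist A B <= r <-> forall x, `|dset A x - dset B x|%:E <= r.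
Proof.
move=> A0 B0; rewrite hausdorff_distE//.
(* One-sided bound: [dset D x <= edist x c + dset D c] for every [c] in [C], then the infimum over
   [c]. *)
have one C D (s : \bar R) x : C !=set0 -> D !=set0 ->
    (forall c, C c -> (dset D c)%:E <= s) -> (dset D x - dset C x)%:E <= s.
  move=> C0 D0; case: s => [s||] Cs; rewrite ?leey//; last first.
    by case: C0 => c /Cs.
  rewrite lee_fin lerBlDl -lerBlDr; apply: dset_ge => // c Cc.
  rewrite lerBlDl (le_trans (dset_lipschitz x c D0))// lerD2r.
  by rewrite -lee_fin Cs.
split=> [|AB].
  rewrite ge_max => /andP[sA sB] x.
  have [le_dset|/ltW le_dset] := leP (dset B x) (dset A x).
    rewrite ger0_norm ?subr_ge0//; apply: one => // b Bb.
    by apply: le_trans sB; apply: ereal_sup_ubound; exists b.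
  rewrite ler0_norm ?subr_le0// opprB; apply: one => // a Aa.
  by apply: le_trans sA; apply: ereal_sup_ubound; exists a.
rewrite ge_max; apply/andP; split; apply: ge_ereal_sup => _ [a Aa <-].
  by rewrite (le_trans _ (AB a))// (dset_eq0 Aa) add0r normrN lee_fin ler_norm.
by rewrite (le_trans _ (AB a))// (dset_eq0 Aa) subr0 lee_fin ler_norm.
Qed.

Lemma dset_le_hausdorff A B x : A !=set0 -> B !=set0 ->
  `|dset A x - dset B x|%:E <= hausdorff_dist A B.
Proof. by move=> A0 B0; apply: (iffLR (hausdorff_leP _ A0 B0)). Qed.

Lemma hausdorff_ge0 A B : A !=set0 -> B !=set0 -> 0 <= hausdorff_dist A B.
Proof.
move=> A0 B0; apply: le_trans (dset_le_hausdorff 0%R A0 B0).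
by rewrite lee_fin.
Qed.

Lemma hausdorffC A B : hausdorff_dist A B = hausdorff_dist B A.
Proof.
by rewrite /hausdorff_dist maxC; congr maxe; congr ereal_sup;
  apply: eq_imagel => x _; congr ereal_inf; apply: eq_imagel => y _;
  rewrite edistC.
Qed.

Lemma hausdorff_triangle B A C : A !=set0 -> B !=set0 -> C !=set0 ->
  hausdorff_dist A C <= hausdorff_dist A B + hausdorff_dist B C.
Proof.
move=> A0 B0 C0; apply/hausdorff_leP => // x.
apply: le_trans (leeD (dset_le_hausdorff x A0 B0) (dset_le_hausdorff x B0 C0)).
by rewrite -EFinD lee_fin ler_distD.
Qed.

(** Distance functions reverse inclusion, so [dset A - dset B] lies between 0 and [dset A - dset C]
    everywhere. *)
Lemma hausdorff_le_nested A B C : A !=set0 -> B !=set0 -> C !=set0 ->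
  A `<=` B -> B `<=` C -> hausdorff_dist A B <= hausdorff_dist A C.
Proof.
move=> A0 B0 C0 AB BC; apply/hausdorff_leP => // x.
apply: le_trans (dset_le_hausdorff x A0 C0).
have AleB := dset_anti x A0 AB; have BleC := dset_anti x B0 BC.
have CleA := le_trans BleC AleB.
by rewrite lee_fin !ger0_norm ?subr_ge0// lerD2l lerN2.
Qed.

Lemma hausdorff_le_set0 A (M : \bar R) : A !=set0 ->
  hausdorff_dist A [set 0%R] <= M <-> forall a, A a -> (edist a 0)%:E <= M.
Proof.
move=> A0; split=> [AM a Aa|AM].
  apply: le_trans AM.
  have z0 : [set (0%R : 'rV[R]_m)] !=set0 by exists 0%R.
  apply: le_trans (dset_le_hausdorff a A0 z0).
  by rewrite dset_eq0// dset_set1 lee_fin add0r normrN ler_norm.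
rewrite hausdorff_distE//; last by exists 0%R.
rewrite ge_max; apply/andP; split; apply: ge_ereal_sup.
  by move=> _ [a Aa <-]; rewrite dset_set1; exact: AM.
move=> _ [b -> <-]; case: A0 => a Aa; rewrite (le_trans _ (AM a Aa))//.
by rewrite lee_fin edistC dset_le.
Qed.

Lemma hausdorff_le_fin A B (e : R) : A !=set0 -> B !=set0 ->
  (forall a, A a -> exists2 b, B b & edist a b <= e)%R ->
  (forall b, B b -> exists2 a, A a & edist b a <= e)%R ->
  hausdorff_dist A B <= e%:E.
Proof.
move=> A0 B0 AB BA; rewrite hausdorff_distE// ge_max.
apply/andP; split; apply: ge_ereal_sup => _ [x xA <-]; rewrite lee_fin.
  by have [b Bb] := AB x xA; apply: le_trans; exact: dset_le.
by have [a Aa] := BA x xA; apply: le_trans; exact: dset_le.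
Qed.

Lemma hausdorff_eq0 A B : A !=set0 -> B !=set0 -> closed A -> closed B ->
  hausdorff_dist A B = 0 -> A = B.
Proof.
move=> A0 B0 clA clB AB; have {}AB x : dset A x = dset B x.
  have := dset_le_hausdorff x A0 B0; rewrite AB lee_fin normr_le0 subr_eq0.
  by move/eqP.
apply/seteqP; split=> x xAB; apply: closed_dset => //.
  by rewrite -AB dset_eq0.
by rewrite AB dset_eq0.
Qed.

End hausdorff.

(** * Lp norms on a set *)

Section Lp_norm_on_a_set.
Context d (T : measurableType d) (R : realType).
Variable mu : {measure set T -> \bar R}.
Implicit Types (D : set T) (f g h : T -> \bar R) (p : R).
Local Open Scope ereal_scope.

(** The shape is that of the integrals in the definitions, so that [dpE] holds by conversion; the
    value [+oo] is allowed for [f]. *)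
Definition LpN p D f : \bar R := (\int[mu]_(x in D) (f x `^ p)) `^ p^-1.

Lemma ge0_le_poweR (x y : \bar R) p : (0 <= p)%R -> 0 <= x -> x <= y ->
  x `^ p <= y `^ p.
Proof.
by move=> p0 x0 xy; apply: gt0_ler_poweR => //;
  rewrite in_itv/= ?leey ?andbT// (le_trans x0).
Qed.

Lemma poweRVK (x : \bar R) p : (0 < p)%R -> 0 <= x -> (x `^ p^-1) `^ p = x.
Proof. by move=> p0 x0; rewrite -poweRrM mulVf ?gt_eqF// poweRe1. Qed.

Lemma poweRKV (x : \bar R) p : (0 < p)%R -> 0 <= x -> (x `^ p) `^ p^-1 = x.
Proof. by move=> p0 x0; rewrite -poweRrM mulfV ?gt_eqF// poweRe1. Qed.

Lemma LpN_ge0 p D f : 0 <= LpN p D f. Proof. exact: poweR_ge0. Qed.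

Lemma measurable_poweR_comp p D f : measurable_fun D f ->
  measurable_fun D (fun x => f x `^ p).
Proof. by move=> mf; exact: measurableT_comp (measurable_poweR p) mf. Qed.

Lemma LpN_le_pow p D f (c : \bar R) : (0 < p)%R -> 0 <= c ->
  LpN p D f <= c <-> \int[mu]_(x in D) (f x `^ p) <= c `^ p.
Proof.
move=> p0 c0; have I0 : 0 <= \int[mu]_(x in D) (f x `^ p).
  by apply: integral_ge0 => x _; exact: poweR_ge0.
split=> [H|H].
  by rewrite -(poweRVK p0 I0) ge0_le_poweR ?(ltW p0) ?poweR_ge0.
by rewrite -(poweRKV p0 c0) ge0_le_poweR ?invr_ge0 ?(ltW p0).
Qed.

Lemma ae_LpN_le p D f g : (0 < p)%R -> measurable D ->
  measurable_fun D f -> measurable_fun D g ->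
  {ae mu, forall x, D x -> 0 <= f x <= g x} -> LpN p D f <= LpN p D g.
Proof.
move=> p0 mD mf mg fg; rewrite ge0_le_poweR ?invr_ge0 ?(ltW p0)//.
  by apply: integral_ge0 => x _; exact: poweR_ge0.
apply: ae_ge0_le_integral => //; first by move=> x _; exact: poweR_ge0.
- exact: measurable_poweR_comp.
- by move=> x _; exact: poweR_ge0.
- exact: measurable_poweR_comp.
- apply: filterS fg => x fg /fg /andP[f0 fgx].
  by rewrite ge0_le_poweR ?(ltW p0).
Qed.

Lemma LpN_le p D f g : (0 < p)%R -> measurable D ->
  measurable_fun D f -> measurable_fun D g ->
  (forall x, D x -> 0 <= f x <= g x) -> LpN p D f <= LpN p D g.
Proof. by move=> p0 mD mf mg fg; apply: ae_LpN_le => //; exact: aeW. Qed.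

Lemma LpN_lty_ae p D f : (0 < p)%R -> measurable D -> measurable_fun D f ->
  (forall x, D x -> 0 <= f x) -> LpN p D f < +oo ->
  {ae mu, forall x, D x -> f x \is a fin_num}.
Proof.
move=> p0 mD mf f0 fy.
have /integrable_ae : mu.-integrable D (fun x => f x `^ p).
  apply/integrableP; split; first exact: measurable_poweR_comp.
  under eq_integral do rewrite gee0_abs ?poweR_ge0//.
  by apply: (@lty_poweRy _ _ p^-1); rewrite ?invr_eq0 ?gt_eqF.
move=> /(_ mD); apply: filterS => x fx Dx.
rewrite ge0_fin_numE ?f0//; apply: (@lty_poweRy _ _ p); rewrite ?gt_eqF//.
by rewrite -ge0_fin_numE ?poweR_ge0 ?fx.
Qed.

(** A finite norm makes [f] finite almost everywhere, so [fine] alters it on a null set only. The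
    right side is in the form to which Minkowski's inequality applies. *)
Lemma LpN_fine p D f : (0 < p)%R -> measurable D -> measurable_fun D f ->
  (forall x, D x -> 0 <= f x) -> LpN p D f < +oo ->
  LpN p D f = Lnorm mu p%:E (EFin \o (fine \o f \_ D)).
Proof.
move=> p0 mD mf f0 fy; rewrite unlock/= /LpN.
rewrite [in LHS]integral_mkcond; congr (_ `^ _).
have m1 : measurable_fun setT ((fun x => f x `^ p) \_ D).
  by apply/(measurable_restrictT _ mD); exact: measurable_poweR_comp.
have mfD : measurable_fun setT (f \_ D) by apply/(measurable_restrictT _ mD).
apply: ae_eq_integral => //.
  have mfine : measurable_fun setT (fun x => `|fine ((f \_ D) x)|%:E).
    by apply/measurable_EFinP; do 2 apply: measurableT_comp => //.
  exact: (measurable_poweR_comp p mfine).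
have := LpN_lty_ae p0 mD mf f0 fy; apply: filterS => x fx _.
rewrite /= /patch; case: ifPn => [|xD].
  rewrite inE => Dx; rewrite /= ger0_norm ?fine_ge0 ?f0//.
  by rewrite -poweR_EFin fineK ?fx.
by rewrite /= normr0 powR0// gt_eqF.
Qed.

(** Minkowski and monotonicity in one statement: this is how a triangle inequality valid at each
    level is integrated. Infinite norms on the right are trivial cases. *)
Lemma LpN_triangle p D f g h : (1 <= p)%R -> measurable D ->
  measurable_fun D f -> measurable_fun D g -> measurable_fun D h ->
  (forall x, D x -> 0 <= f x) -> (forall x, D x -> 0 <= g x) ->
  (forall x, D x -> 0 <= h x <= f x + g x) ->
  LpN p D h <= LpN p D f + LpN p D g.
Proof.
move=> p1 mD mf mg mh f0 g0 hfg; have p0 : (0 < p)%R by exact: lt_le_trans p1.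
have [fy|] := ltP (LpN p D f) +oo; last first.
  by rewrite leye_eq => /eqP->; rewrite addye ?leey// -ltNye (lt_le_trans _ (LpN_ge0 _ _ _)).
have [gy|] := ltP (LpN p D g) +oo; last first.
  by rewrite leye_eq => /eqP->; rewrite addey ?leey// -ltNye (lt_le_trans _ (LpN_ge0 _ _ _)).
have mfine (k : T -> \bar R) : measurable_fun D k ->
    measurable_fun setT (fine \o k \_ D).
  by move=> mk; apply: measurableT_comp => //; apply/(measurable_restrictT _ mD).
rewrite (LpN_fine p0 mD mf)// (LpN_fine p0 mD mg)//.
apply: le_trans (minkowski_EFin mu (mfine _ mf) (mfine _ mg) p1).
rewrite unlock/= /LpN ge0_le_poweR ?invr_ge0 ?(ltW p0)//.
  by apply: integral_ge0 => x _; exact: poweR_ge0.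
rewrite integral_mkcond; apply: ae_ge0_le_integral => //.
- by move=> x _; rewrite /patch; case: ifPn => // _; exact: poweR_ge0.
- by apply/(measurable_restrictT _ mD); exact: measurable_poweR_comp.
- have mfg : measurable_fun setT
      (fun x => `|fine ((f \_ D) x) + fine ((g \_ D) x)|%:E).
    apply/measurable_EFinP; apply: measurableT_comp => //.
    by apply: measurable_funD; exact: mfine.
  exact: (measurable_poweR_comp p mfg).
- have := LpN_lty_ae p0 mD mg g0 gy; have := LpN_lty_ae p0 mD mf f0 fy.
  apply: filterS2 => x fx gx _; rewrite /= /patch; case: ifPn => [|xD].
    rewrite inE => Dx; have /andP[h0 hle] := hfg x Dx.
    rewrite -fineD ?fx ?gx// ger0_norm ?fine_ge0 ?adde_ge0 ?f0 ?g0//.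
    rewrite -poweR_EFin fineK ?fin_numD ?fx ?gx//.
    by rewrite ge0_le_poweR ?(ltW p0).
  by rewrite lee_fin powR_ge0.
Qed.

(** [f] is at most the sum of its extensions by zero from [D1] and [D2]. The sets may overlap, so
    closed intervals with a common endpoint can be used. *)
Lemma LpN_setU p D1 D2 f : (1 <= p)%R -> measurable D1 -> measurable D2 ->
  measurable_fun (D1 `|` D2) f -> (forall x, (D1 `|` D2) x -> 0 <= f x) ->
  LpN p (D1 `|` D2) f <= LpN p D1 f + LpN p D2 f.
Proof.
move=> p1 mD1 mD2 mf f0; have p0 : (0 < p)%R by exact: lt_le_trans p1.
have mD : measurable (D1 `|` D2) by exact: measurableU.
have pE D : D `<=` D1 `|` D2 -> LpN p D f = LpN p (D1 `|` D2) (f \_ D).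
  move=> DD; congr (_ `^ _); rewrite integral_mkcond [RHS]integral_mkcond.
  apply: eq_integral => x _; rewrite /patch; case: ifPn => [|xD].
    by rewrite inE => /DD xDD; rewrite mem_set.
  by case: ifPn => // _; rewrite poweR0r// gt_eqF.
have mE D : measurable D -> D `<=` D1 `|` D2 ->
    measurable_fun (D1 `|` D2) (f \_ D).
  move=> mD' DD; apply: measurable_funTS; apply/(measurable_restrictT _ mD').
  exact: measurable_funS mf.
have pge0 D : D `<=` D1 `|` D2 -> forall x, (D1 `|` D2) x -> 0 <= (f \_ D) x.
  by move=> DD x Dx; rewrite /patch; case: ifPn => // _; exact: f0.
rewrite (pE D1)// (pE D2)//.
apply: LpN_triangle => //; [exact: mE|exact: mE|exact: pge0|exact: pge0|].
move=> x Dx; rewrite f0//=; case: (Dx) => Dix.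
  by rewrite {1}/patch mem_set//= leeDl// pge0.
by rewrite [X in _ + X]/patch mem_set//= leeDr// pge0.
Qed.

Lemma LpN_subset p D1 D2 f : (0 < p)%R -> measurable D1 -> measurable D2 ->
  measurable_fun D2 f -> D1 `<=` D2 -> LpN p D1 f <= LpN p D2 f.
Proof.
move=> p0 mD1 mD2 mf D12; rewrite ge0_le_poweR ?invr_ge0 ?(ltW p0)//.
  by apply: integral_ge0 => x _; exact: poweR_ge0.
apply: ge0_subset_integral => //; first exact: measurable_poweR_comp.
by move=> x _; exact: poweR_ge0.
Qed.

Lemma LpN_cst p D (c : R) : (0 < p)%R -> measurable D -> (0 <= c)%R ->
  LpN p D (cst c%:E) = c%:E * mu D `^ p^-1.
Proof.
move=> p0 mD c0; rewrite /LpN.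
have -> : \int[mu]_(x in D) (cst c%:E x `^ p) = c%:E `^ p * mu D.
  exact: (integral_cst mu mD).
by rewrite poweRM ?poweR_ge0// poweRKV.
Qed.

Lemma eq_LpN p D f g : (forall x, D x -> f x = g x) -> LpN p D f = LpN p D g.
Proof.
by move=> fg; congr (_ `^ _); apply: eq_integral => x; rewrite inE => /fg->.
Qed.

Lemma LpN_eq0 p D f : (0 < p)%R -> measurable D -> measurable_fun D f ->
  (forall x, D x -> 0 <= f x) -> LpN p D f = 0 ->
  {ae mu, forall x, D x -> f x = 0}.
Proof.
move=> p0 mD mf f0 fN0.
have I0 : \int[mu]_(x in D) `|f x `^ p| = 0.
  under eq_integral do rewrite gee0_abs ?poweR_ge0//.
  apply/eqP; rewrite eq_le integral_ge0 ?andbT; last by move=> x _; exact: poweR_ge0.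
  have := (LpN_le_pow D f p0 (lexx 0)).1; rewrite fN0 poweR0r ?gt_eqF//.
  exact.
have /ae_eq_integral_abs := I0.
move=> /(_ mD (measurable_poweR_comp p mf)); apply: filterS => x fx Dx.
have := fx Dx; rewrite /cst => /poweR_eq0_eq0; apply; exact: f0.
Qed.

End Lp_norm_on_a_set.

(** * Translation invariance of Lebesgue measure *)

Section lebesgue_translation.
Context (R : realType).
Local Notation mu := (@lebesgue_measure R).
Local Open Scope ereal_scope.

(** The pushforward agrees with Lebesgue measure on half-open intervals, which determine the
    measure. *)
Lemma lebesgue_measure_shift (h : R) (A : set R) : measurable A ->
  pushforward mu (fun x : measurableTypeR R => (x - h)%R : measurableTypeR R) A
  = mu A.
Proof.
have ms : measurable_fun setT (fun x : measurableTypeR R => (x - h)%R : measurableTypeR R).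
  exact: measurable_funB.
pose phi : {mfun measurableTypeR R >-> measurableTypeR R} :=
  HB.pack (fun x : measurableTypeR R => (x - h)%R : measurableTypeR R)
   (isMeasurableFun.Build _ _ _ _ _ ms).
move=> mA; apply/esym.
apply: (@lebesgue_measure_unique _ (pushforward mu phi)) => // _ [[a b]] _ <-.
rewrite /pushforward.
rewrite [RHS](_ : _ = mu `](a + h)%R, (b + h)%R]%classic); last first.
  congr (mu _).
  have shE (x : R) : ((x - h)%R \in `]a, b]) = (x \in `](a + h)%R, (b + h)%R]).
    by rewrite !in_itv/= ltrBrDr lerBlDr.
  apply/seteqP; split=> x xab.
    have : (x - h)%R \in `]a, b] by exact: xab.
    rewrite shE; exact.
  have : x \in `](a + h)%R, (b + h)%R] by exact: xab.
  rewrite -shE; exact.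
rewrite !lebesgue_measure_itv/= !lte_fin ltrD2r; case: ifPn => // _.
by rewrite -!EFinB; congr EFin; ring.
Qed.

Lemma LpN_shift p (h a b : R) (f : R -> \bar R) :
  measurable_fun `[a, b] f -> (forall x, `[a, b]%classic x -> 0 <= f x) ->
  LpN mu p `[(a + h)%R, (b + h)%R] (fun x => f (x - h)%R) = LpN mu p `[a, b] f.
Proof.
move=> mf f0; congr (_ `^ _).
have ms : measurable_fun setT (fun x : measurableTypeR R => (x - h)%R : measurableTypeR R).
  exact: measurable_funB.
transitivity (\int[pushforward mu (fun x : measurableTypeR R => (x - h)%R : measurableTypeR R)]_(x in `[a, b]) (f x `^ p)).
  rewrite ge0_integral_pushforward//=.
  - have shE (x : R) : ((x - h)%R \in `[a, b]) = (x \in `[(a + h)%R, (b + h)%R]).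
      by rewrite !in_itv/= lerBrDr lerBlDr.
    congr integral; apply/seteqP; split=> x xab.
      have : x \in `[(a + h)%R, (b + h)%R] by exact: xab.
      rewrite -shE; exact.
    have : (x - h)%R \in `[a, b] by exact: xab.
    rewrite shE; exact.
  - exact: measurable_poweR_comp.
  - by move=> x _; exact: poweR_ge0.
apply: eq_measure_integral => //= A mA _; exact: lebesgue_measure_shift.
Qed.

End lebesgue_translation.

(** * Cuts and the metric dp *)

Section rational_points.
Context (R : realType) (m : nat).
Implicit Types (A B : set 'rV[R]_m).
Local Open Scope ereal_scope.

(** A dense sequence rather than a dense set, since suprema of sequences are the ones known to be
    measurable; codes that decode to nothing repeat the point 0. *)
Definition rat_point (n : nat) : 'rV[R]_m :=
  if unpickle n is Some q then map_mx ratr (q : 'rV[rat]_m) else 0%R.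

Lemma exists_rat_point (x : 'rV[R]_m) (e : R) : (0 < e)%R ->
  exists n, (edist x (rat_point n) < e)%R.
Proof.
move=> /(exists_rat_edist x)[q xq]; exists (pickle q).
by rewrite /rat_point pickleK.
Qed.

(** Both distance functions are 1-Lipschitz, so the supremum of their difference can be computed
    along a dense sequence. *)
Lemma hausdorff_esups A B : A !=set0 -> B !=set0 -> hausdorff_dist A B =
  esups (fun n => `|dset A (rat_point n) - dset B (rat_point n)|%:E) 0%N.
Proof.
move=> A0 B0; apply/eqP; rewrite eq_le; apply/andP; split; last first.
  by apply: ge_ereal_sup => _ [n _ <-]; exact: dset_le_hausdorff.
apply/hausdorff_leP => // x; apply/lee_addgt0Pr => e e0.
have e20 : (0 < e / 2)%R by rewrite divr_gt0.
have [n xn] := exists_rat_point x e20.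
apply: (@le_trans _ _ (`|dset A (rat_point n) - dset B (rat_point n)|%:E + e%:E)).
  rewrite -EFinD lee_fin.
  have := dset_lipschitz x (rat_point n) A0; have := dset_lipschitz (rat_point n) x A0.
  have := dset_lipschitz x (rat_point n) B0; have := dset_lipschitz (rat_point n) x B0.
  rewrite (edistC (rat_point n)) => H1 H2 H3 H4.
  have := ler_norm (dset A (rat_point n) - dset B (rat_point n)).
  have := ler_norm (- (dset A (rat_point n) - dset B (rat_point n))).
  by rewrite normrN => H5 H6; rewrite ler_norml; apply/andP; split; lra.
by rewrite leeD2r// ereal_sup_ubound//; exists n.
Qed.

(** For a decreasing family of sets, [t |-> dset (C t) x] is nondecreasing, hence measurable. *)
Lemma measurable_hausdorff (a b : R) (A B : R -> set 'rV[R]_m) :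
  (forall t, a <= t <= b -> A t !=set0)%R ->
  (forall t, a <= t <= b -> B t !=set0)%R ->
  (forall s t, a <= s -> s <= t -> t <= b -> A t `<=` A s)%R ->
  (forall s t, a <= s -> s <= t -> t <= b -> B t `<=` B s)%R ->
  measurable_fun `[a, b] (fun t => hausdorff_dist (A t) (B t)).
Proof.
move=> A0 B0 Aanti Banti.
have mdset (C : R -> set 'rV[R]_m) : (forall t, a <= t <= b -> C t !=set0)%R ->
    (forall s t, a <= s -> s <= t -> t <= b -> C t `<=` C s)%R ->
    forall x, measurable_fun `[a, b] (fun t => dset (C t) x).
  move=> C0 Canti x; have [ab|ba] := leP a b; last first.
    by rewrite set_itv_ge -?ltNge//; exact: measurable_fun_set0.
  (* Outside [[a, b]] nothing is known about [C]; clamping gives a function monotone on the whole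
     line. *)
  pose clamp t := (Num.min b (Num.max a t))%R.
  have clampab t : (a <= clamp t <= b)%R.
    by rewrite /clamp ge_min lexx le_min ab/= le_max lexx.
  have := @nondecreasing_measurable R `[a, b] (fun t => dset (C (clamp t)) x).
  have homo_clamp : {homo clamp : s t / (s <= t)%R}.
    move=> s t st; rewrite /clamp.
    have [] := leP a s; have [] := leP a t => at_ as_; rewrite !(minElt, maxElt);
    by do ![case: ifPn => ?]; lra.
  move=> /(_ (measurable_itv _)) H.
  apply: (eq_measurable_fun (fun t => dset (C (clamp t)) x)).
    move=> t; rewrite inE/= in_itv/= => /andP[at_ tb].
    by rewrite /clamp (max_idPr at_) (min_idPr tb).
  apply: H => s t /homo_clamp st; apply: dset_anti.
    exact/C0/clampab.
  by have /andP[? ?] := clampab s; have /andP[? ?] := clampab t; exact: Canti.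
apply: (eq_measurable_fun (fun t => esups (fun n =>
    `|dset (A t) (rat_point n) - dset (B t) (rat_point n)|%:E) 0%N)).
  move=> t; rewrite inE/= in_itv/= => tab.
  by rewrite -hausdorff_esups//; [exact: A0|exact: B0].
apply: (@measurable_fun_esups _ _ _ _ (fun n t =>
  `|dset (A t) (rat_point n) - dset (B t) (rat_point n)|%:E)) => n.
apply/measurable_EFinP; apply: measurableT_comp => //.
by apply: measurable_funB; exact: mdset.
Qed.

End rational_points.

Lemma ae_lebesgue_itv (R : realType) (P : R -> Prop) (D : set R) (a b : R) :
  {ae (@lebesgue_measure R), forall x, D x -> P x} -> a < b ->
  `]a, b[ `<=` D -> exists2 x, a < x < b & P x.
Proof.
move=> [N [mN N0 DN]] ab abD; apply: contrapT => /forall2NP nP.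
have abN : `]a, b[ `<=` N.
  move=> x xab; apply: DN => /= DP.
  by case: (nP x); [move: xab; rewrite /= in_itv|apply; exact/DP/abD].
have : (lebesgue_measure `]a, b[%classic <= lebesgue_measure N)%E.
  by apply: le_measure; rewrite ?inE//; exact: measurable_itv.
by rewrite N0 lebesgue_measure_itv/= lte_fin ab -EFinB lee_fin; lra.
Qed.

Section cuts.
Context (R : realType) (m : nat).
Implicit Types (u v w : 'rV[R]_m -> R) (a b p : R).

Lemma fcut_gt0 u a : 0 < a -> fcut u a = [set x | a <= u x].
Proof. by move=> a0; rewrite /fcut gt_eqF. Qed.

Lemma fcut_anti u a b : 0 <= a -> a <= b -> fcut u b `<=` fcut u a.
Proof.
move=> a0 ab x; rewrite /fcut.
have [b0|bN0] := eqVneq b 0.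
  have -> : a = 0 by apply/eqP; rewrite eq_le a0 -b0 ab.
  by rewrite eqxx.
have b0 : 0 < b by rewrite lt_neqAle eq_sym bN0 (le_trans a0).
case: ifPn => [_|_] /= bu; last exact: le_trans bu.
by apply: subset_closure; exact: lt_le_trans bu.
Qed.

Lemma fcut_nonempty u a : normal u -> 0 <= a <= 1 -> fcut u a !=set0.
Proof.
move=> [x ux1] /andP[a0 a1]; exists x; apply: (fcut_anti a0 a1).
by rewrite fcut_gt0//= ux1.
Qed.

Lemma closed_fcut u a : upper_semicontinuous u -> closed (fcut u a).
Proof.
move=> usc; rewrite /fcut; case: ifPn => _; first exact: closed_closure.
move=> x clx /=; rewrite leNgt; apply/negP => /usc/clx[y /= [ay ya]].
by move: ya; rewrite ltNge ay.
Qed.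

Lemma fcut_hat0 a : 0 <= a <= 1 -> fcut (@hat0 R m) a = [set 0].
Proof.
move=> /andP[a0 a1]; have pos b : 0 < b -> b <= 1 ->
    [set x | b <= @hat0 R m x] = [set 0].
  move=> b0 b1; apply/seteqP; split=> x /=; rewrite /hat0 indicE.
    by case: (boolP (x \in _)) => [|_]; [rewrite inE|rewrite leNgt b0].
  by move=> ->; rewrite mem_set.
rewrite /fcut; case: ifPn => [_|aN0]; last first.
  by rewrite pos// lt_neqAle eq_sym aN0.
have -> : [set x | 0 < @hat0 R m x] = [set 0].
  apply/seteqP; split=> x /=; rewrite /hat0 indicE.
    by case: (boolP (x \in _)) => [|_]; [rewrite inE|rewrite ltxx].
  by move=> ->; rewrite mem_set.
apply/esym/closure_id/accessible_closed_set1/hausdorff_accessible.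
exact: norm_hausdorff.
Qed.

Lemma normal_hat0 : normal (@hat0 R m).
Proof. by exists 0; rewrite /hat0 indicE mem_set. Qed.

End cuts.

Section dp_theory.
Context (R : realType) (m : nat) (p : R).
Hypothesis p1 : 1 <= p.
Implicit Types (u v w : 'rV[R]_m -> R) (a b : R).
Local Notation mu := (@lebesgue_measure R).
Local Open Scope ereal_scope.

Let p0 : (0 < p)%R. Proof. exact: lt_le_trans p1. Qed.

Definition hcut u v a : \bar R := hausdorff_dist (fcut u a) (fcut v a).

Lemma dpE u v : dp p u v = LpN mu p `[0%R, 1%R] (hcut u v). Proof. by []. Qed.

Lemma hcut_ge0 u v a : normal u -> normal v -> (0 <= a <= 1)%R -> 0 <= hcut u v a.
Proof. by move=> nu nv a01; apply: hausdorff_ge0; exact: fcut_nonempty. Qed.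

Lemma hcut_triangle v u w a : normal u -> normal v -> normal w ->
  (0 <= a <= 1)%R -> hcut u w a <= hcut u v a + hcut v w a.
Proof. by move=> ? ? ? ?; apply: hausdorff_triangle; exact: fcut_nonempty. Qed.

Lemma hcutC u v a : hcut u v a = hcut v u a.
Proof. exact: hausdorffC. Qed.

Lemma measurable_hcut u v a b : normal u -> normal v -> (0 <= a)%R -> (b <= 1)%R ->
  measurable_fun `[a, b] (hcut u v).
Proof.
move=> nu nv a0 b1.
apply: measurable_hausdorff => [t /andP[at_ tb]|t /andP[at_ tb]|s t as_ st tb|s t as_ st tb].
- by apply: fcut_nonempty => //; rewrite (le_trans a0)//= (le_trans tb).
- by apply: fcut_nonempty => //; rewrite (le_trans a0)//= (le_trans tb).
- by apply: fcut_anti => //; exact: le_trans as_.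
- by apply: fcut_anti => //; exact: le_trans as_.
Qed.

Lemma in01 a : `[0%R, 1%R]%classic a -> (0 <= a <= 1)%R.
Proof. by rewrite /= in_itv. Qed.

Lemma dp_ge0 u v : 0 <= dp p u v. Proof. exact: LpN_ge0. Qed.

Lemma dpC u v : dp p u v = dp p v u.
Proof. by rewrite !dpE; apply: eq_LpN => a _; exact: hcutC. Qed.

Lemma dp_triangle v u w : normal u -> normal v -> normal w ->
  dp p u w <= dp p u v + dp p v w.
Proof.
move=> nu nv nw; rewrite !dpE; apply: LpN_triangle => //.
- exact: measurable_hcut.
- exact: measurable_hcut.
- exact: measurable_hcut.
- by move=> a /in01 a01; exact: hcut_ge0.
- by move=> a /in01 a01; exact: hcut_ge0.
- by move=> a /in01 a01; rewrite hcut_ge0//= hcut_triangle.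
Qed.

Lemma hcut_hat0 u a : (0 <= a <= 1)%R ->
  hcut u (@hat0 R m) a = hausdorff_dist (fcut u a) [set 0%R].
Proof. by move=> a01; rewrite /hcut fcut_hat0. Qed.

Lemma FBpE u : FBp p u <->
  [/\ fuzzy u, normal u, upper_semicontinuous u & dp p u (@hat0 R m) < +oo].
Proof.
have E : dp p u (@hat0 R m) =
    LpN mu p `[0%R, 1%R] (fun a => hausdorff_dist (fcut u a) [set 0%R]).
  by apply: eq_LpN => a /in01; exact: hcut_hat0.
by split=> -[fu nu su du]; (apply: And4;
  [exact: fu|exact: nu|exact: su|move: du; rewrite E]).
Qed.

Lemma LpN_itv_le (f : R -> \bar R) a b (c : R) : (a <= b)%R -> (0 <= c)%R ->
  measurable_fun `[a, b] f -> (forall t, (a <= t <= b)%R -> 0 <= f t <= c%:E) ->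
  LpN mu p `[a, b] f <= c%:E * ((b - a)%R `^ p^-1)%:E.
Proof.
move=> ab c0 mf fc.
have -> : ((b - a)%R `^ p^-1)%:E = mu `[a, b]%classic `^ p^-1.
  rewrite lebesgue_measure_itv/= lte_fin; case: ltP => [ab'|ba].
    by rewrite -EFinB poweR_EFin.
  have -> : a = b by apply/eqP; rewrite eq_le ab ba.
  by rewrite subrr powR0 ?invr_eq0 ?gt_eqF// poweR0r// invr_eq0 gt_eqF.
by rewrite -LpN_cst//; apply: LpN_le => // t; rewrite /= in_itv; exact: fc.
Qed.

Lemma FB_bound u : FB u ->
  exists2 M : R, (0 < M)%R & forall a, (0 <= a <= 1)%R -> forall x, fcut u a x -> (edist x 0 <= M)%R.
Proof.
move=> [_ _ _ /edist_bounded_set[M M0 uM]]; exists M => // a /andP[a0 a1] x ux.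
exact/uM/(fcut_anti (lexx _) a0).
Qed.

Lemma sub_FB_FBp : @FB R m `<=` FBp p.
Proof.
move=> u FBu; have [fu nu su _] := FBu; apply/FBpE; split=> //.
have [M M0 uM] := FB_bound FBu.
apply: (@le_lt_trans _ _ (M%:E * ((1 - 0)%R `^ p^-1)%:E)); last by rewrite ltry.
have nh := normal_hat0 R m.
rewrite dpE; apply: LpN_itv_le => //; [exact: ltW|exact: measurable_hcut|].
move=> t t01; apply/andP; split; first exact: hcut_ge0.
rewrite hcut_hat0//; apply/hausdorff_le_set0.
  exact: fcut_nonempty.
by move=> x /(uM _ t01); rewrite lee_fin.
Qed.

(** A Chebyshev estimate: a point of the cut at [h] lies in all cuts at levels in [[0, h]], so the
    norm is at least [edist x 0 * h^(1/p)]. *)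
Lemma dp_hat0_fcut u h x (M : R) : normal u -> (0 < h <= 1)%R ->
  dp p u (@hat0 R m) <= M%:E -> fcut u h x -> (edist x 0 <= M / h `^ p^-1)%R.
Proof.
move=> nu /andP[h0 h1] uM ux.
rewrite ler_pdivlMr ?powR_gt0// -lee_fin; apply: le_trans uM.
rewrite EFinM dpE; apply: (@le_trans _ _ (LpN mu p `[0%R, h] (hcut u (@hat0 R m)))); last first.
  apply: LpN_subset => //; first by apply: measurable_hcut => //; exact: normal_hat0.
  by move=> t; rewrite /= !in_itv/= => /andP[-> th]; exact: le_trans h1.
have <- : LpN mu p `[0%R, h] (cst (edist x 0)%:E) =
    (edist x 0)%:E * (h `^ p^-1)%:E.
  rewrite LpN_cst ?edist_ge0//; congr (_ * _); rewrite -poweR_EFin.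
  congr (_ `^ _).
  by rewrite [LHS]lebesgue_measure_itv/= lte_fin h0 -EFinB subr0.
apply: LpN_le => //; first by apply: measurable_hcut => //; exact: normal_hat0.
move=> t; rewrite /= in_itv/= lee_fin edist_ge0/= => /andP[t0 th].
have t01 : (0 <= t <= 1)%R by rewrite t0 (le_trans th).
rewrite hcut_hat0//; apply: (hausdorff_le_set0 _ (fcut_nonempty nu t01)).1 => //.
exact: fcut_anti th _ ux.
Qed.

(** If [v x < u x], then [x] separates the cuts of [u] and [v] at every level strictly between. That
    interval is not null, while closed cuts at distance 0 coincide and almost all cuts are at
    distance 0. *)
Lemma dp_eq0_le u v : FBp p u -> FBp p v -> dp p u v = 0 -> forall x, (u x <= v x)%R.
Proof.
move=> /FBpE[fu nu su _] /FBpE[fv nv sv _] uv0 x; rewrite leNgt; apply/negP => vu.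
have := @LpN_eq0 _ _ _ mu _ _ _ p0 (measurable_itv `[0%R, 1%R]) (measurable_hcut nu nv (lexx _) (lexx _)).
have h0 a : `[0%R, 1%R]%classic a -> 0 <= hcut u v a by move=> /in01; exact: hcut_ge0.
move=> /(_ h0 uv0) /ae_lebesgue_itv/(_ vu)[].
  have /andP[_ u1] := fu x; have /andP[v0 _] := fv x.
  move=> t; rewrite /= !in_itv/= => /andP[vt tu].
  by rewrite (le_trans v0) ?ltW// (lt_le_trans tu).
move=> t /andP[vt tu].
have /andP[_ u1] := fu x; have /andP[v0 _] := fv x.
have t01 : (0 <= t <= 1)%R by rewrite (le_trans v0) ?ltW// (lt_le_trans tu).
have t0 : (0 < t)%R by exact: le_lt_trans vt.
move/hausdorff_eq0 => /(_ (fcut_nonempty nu t01) (fcut_nonempty nv t01)).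
move=> /(_ (@closed_fcut _ _ u t su) (@closed_fcut _ _ v t sv)); rewrite !fcut_gt0//.
move=> /seteqP[/(_ x)/= uv _]; have := uv (ltW tu); lra.
Qed.

Lemma dp_eq0 u v : FBp p u -> FBp p v -> dp p u v = 0 -> u = v.
Proof.
move=> FBu FBv uv0; apply/funext => x; apply/le_anti/andP.
have vu0 : dp p v u = 0 by rewrite dpC.
by split; [exact: (dp_eq0_le FBu FBv uv0)|exact: (dp_eq0_le FBv FBu vu0)].
Qed.

End dp_theory.

(** * Balls and neighbourhoods for [dp] *)

Section dp_space_topology.
Context (R : realType) (m : nat) (p : R) (X : set ('rV[R]_m -> R)).
Hypothesis p1 : 1 <= p.
Hypothesis Xnormal : forall u, X u -> normal u.
Implicit Types (u v : dp_space p X).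

Definition dp_ball u (r : R) : set (dp_space p X) :=
  [set v | (dp p (sval u) (sval v) < r%:E)%E].

Lemma dp_space_openP (A : set (dp_space p X)) : open A <-> dp_open A.
Proof. by []. Qed.

Lemma nbhs_dp_ball u (A : set (dp_space p X)) : nbhs u A ->
  exists2 r, 0 < r & dp_ball u r `<=` A.
Proof.
rewrite nbhsE => -[B [oB Bu] BA].
by have [r r0 rB] := oB _ Bu; exists r => // v /rB/BA.
Qed.

Lemma dpxx (w : 'rV[R]_m -> R) : normal w -> dp p w w = 0%E.
Proof.
move=> nw; have p0 : 0 < p by exact: lt_le_trans p1.
apply/eqP; rewrite eq_le dp_ge0 andbT.
have := LpN_itv_le p1 ler01 (lexx 0) (measurable_hcut nw nw (lexx 0) (lexx 1)).
rewrite mul0e; apply=> t t01; rewrite hcut_ge0//=.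
apply/hausdorff_leP; [exact: fcut_nonempty..|].
by move=> x; rewrite subrr normr0.
Qed.

Lemma open_dp_ball u (r : R) : open (dp_ball u r).
Proof.
apply/dp_space_openP => v uvr; rewrite /dp_ball/= in uvr.
pose c := fine (dp p (sval u) (sval v)).
have dE : dp p (sval u) (sval v) = c%:E.
  by rewrite fineK// ge0_fin_numE ?dp_ge0// (lt_trans uvr)// ltry.
exists (r - c); first by rewrite subr_gt0 -lte_fin -dE.
move=> w; rewrite /dp_ball/= => vw.
apply: le_lt_trans (dp_triangle p1 (Xnormal (svalP u)) (Xnormal (svalP v))
  (Xnormal (svalP w))) _.
rewrite dE; move: (dp p (sval v) (sval w)) vw => z.
by rewrite EFinB lteBrDl// addeC.
Qed.

Lemma nbhs_dp_ball_self u (r : R) : 0 < r -> nbhs u (dp_ball u r).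
Proof.
move=> r0; apply: open_nbhs_nbhs; split; first exact: open_dp_ball.
by rewrite /dp_ball/= dpxx ?lte_fin//; apply: Xnormal; exact: svalP.
Qed.

End dp_space_topology.

(** * Necessity *)

(** Cantor's intersection theorem for a family shrinking with a real parameter: the sets [S h]
    generate a proper filter, and a cluster point of it lies in each of them. *)
Lemma nested_compact (R : realType) (T : topologicalType) (K : set T) (r : R)
    (S : R -> set T) : compact K -> 0 < r ->
  (forall h, 0 < h <= r -> S h !=set0) ->
  (forall h, 0 < h <= r -> closed (S h)) ->
  (forall h, 0 < h <= r -> S h `<=` K) ->
  (forall h k, 0 < h -> h <= k -> k <= r -> S h `<=` S k) ->
  exists x, forall h, 0 < h <= r -> S h x.
Proof.
move=> Kc r0 S0 Scl SK Smono.
pose F := filter_from [set h | 0 < h <= r] S.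
have FF : Filter F.
  apply: filter_from_filter; first by exists r; rewrite /= r0 lexx.
  move=> h k /= /andP[h0 hr] /andP[k0 kr].
  exists (Num.min h k); first by rewrite /= lt_min h0 k0 ge_min hr.
  move=> x Sx; split; apply: Smono Sx => //;
    by rewrite ?lt_min ?h0// ge_min lexx ?orbT.
have PF : ProperFilter F by exact: filter_from_proper.
have [|x [Kx Fx]] := Kc F PF.
  by exists r; [rewrite /= r0 lexx|apply: SK; rewrite r0 lexx].
exists x => h hr; apply: Scl => // A Ax.
by apply: (Fx (S h) A) => //; exists h.
Qed.

(** * Left-continuity of a single fuzzy set *)

Section left_continuity.
Context (R : realType) (m : nat) (p : R).
Hypothesis p1 : 1 <= p.
Implicit Types (u v w : 'rV[R]_m -> R) (a b h : R).
Local Notation mu := (@lebesgue_measure R).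

Let p0 : 0 < p. Proof. exact: lt_le_trans p1. Qed.

Definition lcut u h a : \bar R := hausdorff_dist (fcut u a) (fcut u (a - h)).

Lemma lcut_ge0 u h a : normal u -> 0 <= h <= a -> a <= 1 -> (0 <= lcut u h a)%E.
Proof.
move=> nu /andP[h0 ha] a1.
by apply: hausdorff_ge0; apply: fcut_nonempty => //; apply/andP; split; lra.
Qed.

Lemma measurable_lcut u h a : normal u -> 0 <= h <= a ->
  measurable_fun `[a, 1] (lcut u h).
Proof.
move=> nu /andP[h0 ha].
apply: (measurable_hausdorff (A := fcut u) (B := fun t => fcut u (t - h))).
- by move=> t /andP[at_ t1]; apply: fcut_nonempty => //; apply/andP; split; lra.
- by move=> t /andP[at_ t1]; apply: fcut_nonempty => //; apply/andP; split; lra.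
- by move=> s t as_ st t1; apply: fcut_anti => //; lra.
- by move=> s t as_ st t1; apply: fcut_anti => //; lra.
Qed.

Lemma le_lcut u h k a : normal u -> 0 <= h -> h <= k -> k <= a -> a <= 1 ->
  (lcut u h a <= lcut u k a)%E.
Proof.
move=> nu h0 hk ka a1; apply: hausdorff_le_nested.
- by apply: fcut_nonempty => //; apply/andP; split; lra.
- by apply: fcut_nonempty => //; apply/andP; split; lra.
- by apply: fcut_nonempty => //; apply/andP; split; lra.
- by apply: fcut_anti; lra.
- by apply: fcut_anti; lra.
Qed.

Lemma hausdorff_le_bound (A B : set 'rV[R]_m) (M : R) : A !=set0 -> B !=set0 ->
  (forall x, A x -> edist x 0 <= M) -> (forall x, B x -> edist x 0 <= M) ->
  (hausdorff_dist A B <= (M + M)%:E)%E.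
Proof.
move=> A0 B0 AM BM; apply: hausdorff_le_fin => // x.
  case: B0 => b Bb /AM xM; exists b => //.
  by rewrite (le_trans (edist_triangle 0 _ _))// lerD// edistC BM.
case: A0 => a Aa /BM xM; exists a => //.
by rewrite (le_trans (edist_triangle 0 _ _))// lerD// edistC AM.
Qed.

Lemma closed_dset_ge (A : set 'rV[R]_m) (e : R) : A !=set0 ->
  closed [set x | e <= dset A x].
Proof.
move=> A0 x clx /=; rewrite leNgt; apply/negP => xe.
have e0 : 0 < e - dset A x by rewrite subr_gt0.
have [y /= [ey xy]] := clx _ (near_edist x e0).
have := dset_lipschitz y x A0; rewrite edistC; lra.
Qed.

(** The cut at [a > 0] is the intersection of the cuts at lower levels, and a decreasing family of
    compact sets converges to its intersection. Compactness comes from the bounded 0-cut. *)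
Lemma lcut_cvg0 u a (e : R) : FB u -> 0 < a <= 1 -> 0 < e ->
  exists2 r, 0 < r & forall h, 0 <= h -> h < r -> h <= a -> (lcut u h a <= e%:E)%E.
Proof.
move=> FBu /andP[a0 a1] e0; have [fu nu su bu] := FBu.
have ua : fcut u a !=set0 by apply: fcut_nonempty; rewrite // ltW.
have Kc : compact (fcut u 0).
  by apply: bounded_closed_compact => //; exact: closed_fcut.
(* The part of a lower cut that stays [e] away from the cut at [a]. If some [S h] is empty,
   monotonicity in the shift settles all smaller shifts; otherwise the sets have a common point. *)
pose S h := fcut u (a - h) `&` [set x | e <= dset (fcut u a) x].
have [[h [h0 ha] Sh]|nS] :=
  pselect (exists2 h, 0 < h /\ h <= a & S h = set0).
  exists h => // k k0 kh ka.
  apply: (le_trans (le_lcut nu k0 (ltW kh) ha a1)).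
  apply: hausdorff_le_fin => //.
  - by apply: fcut_nonempty => //; apply/andP; split; lra.
  - move=> x ux; exists x; last by rewrite edistxx ltW.
    by apply: fcut_anti ux; lra.
  - move=> x ux; have xe : 0 < e - dset (fcut u a) x.
      rewrite subr_gt0 ltNge; apply/negP => ex.
      by have : S h x by []; rewrite Sh.
    have [y uy xy] := dset_adherent x ua xe.
    by exists y => //; lra.
have [||||x Sx] := @nested_compact R _ _ a S Kc a0.
- move=> h /andP[h0 ha]; apply/set0P/negP => /eqP Sh.
  by apply: nS; exists h.
- move=> h _; apply: closedI; [exact: closed_fcut|exact: closed_dset_ge].
- by move=> h /andP[h0 ha] x [+ _]; apply: fcut_anti; lra.
- by move=> h k h0 hk ka x [ux xe]; split => //; apply: fcut_anti ux; lra.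
have : fcut u a x.
  rewrite fcut_gt0//= leNgt; apply/negP => uxa.
  have ux0 : 0 <= u x by have /andP[] := fu x.
  (* This shift leads to the midpoint of [u x] and [a], a positive level that [u x] does not
     reach. *)
  have hr : 0 < (a - u x) / 2 <= a by apply/andP; split; lra.
  have [+ _] := Sx _ hr; rewrite fcut_gt0/=; lra.
have ha : 0 < a <= a by rewrite a0 lexx.
have [_ /= ex] := Sx _ ha; move/(dset_eq0); lra.
Qed.

(** Dominated convergence on [[0, 1]]: the integrands, extended by zero, tend to 0 at each level by
    [lcut_cvg0] and are at most [(M + M)^p]. A sequence of shifts is enough because [lcut] is
    monotone in the shift. *)
Lemma LpN_lcut_cvg0 u : FB u -> forall eps : R, 0 < eps ->
  \forall n \near \oo, 
    (LpN mu p `[n.+1%:R^-1%R, 1%R] (lcut u n.+1%:R^-1%R) <= eps%:E)%E.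
Proof.
move=> FBu eps eps0; have [fu nu su bu] := FBu.
have [M M0 uM] := FB_bound FBu.
pose k n : R := n.+1%:R^-1.
have k0 n : 0 < k n by rewrite invr_gt0.
have k1 n : k n <= 1 by rewrite invf_le1 ?ler1n.
pose g n : R -> \bar R := (fun a => lcut u (k n) a `^ p)%E \_ `[k n, 1].
have sub n : `[0, 1]%classic `&` `[k n, 1]%classic = `[k n, 1]%classic :> set R.
  apply/setIidr => x; rewrite /= !in_itv/= => /andP[kx ->].
  by rewrite andbT (le_trans (ltW (k0 n))).
have intg n : (\int[mu]_(x in `[0%R, 1%R]) g n x =
    \int[mu]_(x in `[k n, 1%R]) (lcut u (k n) x `^ p))%E.
  by rewrite -(sub n) integral_mkcondr.
have mg (n : nat) : measurable_fun (`[0, 1]%classic : set R) (g n).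
  apply: measurable_funTS; apply/(measurable_restrictT _ (measurable_itv _)).
  by apply: measurable_poweR_comp; apply: measurable_lcut; rewrite // lexx (ltW (k0 n)).
have g0 (n : nat) (x : R) : (0 <= g n x)%E.
  by rewrite /g/patch; case: ifPn => // _; exact: poweR_ge0.
have gM (n : nat) (x : R) : (g n x <= ((M + M) `^ p)%:E)%E.
  rewrite /g/patch; case: ifPn => [|_]; last by rewrite lee_fin powR_ge0.
  rewrite inE/= in_itv/= => /andP[kx x1]; rewrite -poweR_EFin.
  have k0n := k0 n.
  apply: ge0_le_poweR; [exact: ltW|apply: lcut_ge0 => //; apply/andP; split; lra|].
  by apply: hausdorff_le_bound; [apply: fcut_nonempty|apply: fcut_nonempty|apply: uM|apply: uM];
    rewrite //; apply/andP; split; lra.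
have [||||_ _] := @dominated_convergence _ _ _ mu `[0, 1] (measurable_itv _) g
  (cst 0%E) (cst ((M + M) `^ p)%:E) mg.
- exact: measurable_cst.
- apply: aeW => x; rewrite /= in_itv/= => /andP[x0 x1].
  apply/fine_cvgP; split.
    by apply: nearW => n; rewrite ge0_fin_numE// (le_lt_trans (gM n x))// ltry.
  apply/cvgrPdist_le => e e0 /=.
  have [xeq0|xN0] := eqVneq x 0.
    apply: nearW => n; rewrite /g /patch ifF ?sub0r ?normrN ?normr0 ?ltW//.
    by apply/negbTE; rewrite notin_setE/= in_itv/= xeq0 lt_geF.
  have xgt0 : 0 < x by rewrite lt_neqAle eq_sym xN0.
  have x01 : 0 < x <= 1 by rewrite xgt0.
  have ep : 0 < e `^ p^-1 by exact: powR_gt0.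
  have [r r0 ur] := lcut_cvg0 FBu x01 ep.
  have := near_infty_natSinv_lt (PosNum r0); apply: filterS => n /= nr.
  rewrite sub0r normrN ger0_norm ?fine_ge0// -lee_fin fineK; last first.
    by rewrite ge0_fin_numE// (le_lt_trans (gM n x))// ltry.
  rewrite /g /patch; case: ifPn => [|_]; last by rewrite lee_fin ltW.
  rewrite inE/= in_itv/= => /andP[kx _].
  have -> : e%:E = ((e `^ p^-1)%:E `^ p)%E.
    by rewrite poweR_EFin -powRrM mulVf ?gt_eqF// powRr1// ltW.
  apply: ge0_le_poweR; [exact: ltW|apply: lcut_ge0 => //; apply/andP; split|apply: ur] => //;
  exact: ltW.
- apply/integrableP; split; first exact: measurable_cst.
  under eq_integral do rewrite gee0_abs ?lee_fin ?powR_ge0//.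
  rewrite integral_cst//= lebesgue_measure_itv/= lte_fin ltr01 -EFinB -EFinM.
  by rewrite ltry.
- by apply: aeW => x n _; rewrite gee0_abs.
rewrite integral0 => /fine_cvgP[fing].
have ep : 0 < eps `^ p by exact: powR_gt0.
move=> /cvgrPdist_le/(_ _ ep); apply: filterS2 fing => n /= fing.
rewrite sub0r normrN ger0_norm; last by rewrite fine_ge0// integral_ge0.
rewrite -lee_fin fineK// intg => H.
by apply/LpN_le_pow => //; rewrite ?lee_fin ?ltW.
Qed.

(** For [h < k] the interval [[h, 1]] is split at [k]. Above [k] the shift by [h] costs at most the
    shift by [k], which is fixed and small; on the short piece [[h, k]] the bound [M + M] on [lcut]
    suffices. *)
Lemma FB_equi_left_continuous u : FB u -> p_mean_equi_left_continuous p [set u].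
Proof.
move=> FBu eps eps0; have [fu nu su bu] := FBu.
have [M M0 uM] := FB_bound FBu.
have e0 : 0 < eps / 3 by rewrite divr_gt0.
have MM0 : 0 < M + M by rewrite addr_gt0.
(* The threshold up to which [(M + M) * k^(1/p)] is at most [eps / 3]. *)
have r0 : 0 < (eps / 3 / (M + M)) `^ p by apply: powR_gt0; rewrite divr_gt0.
have [n [/= nr nl]] := filter_ex (filterI (near_infty_natSinv_lt (PosNum r0))
  (LpN_lcut_cvg0 FBu e0)).
have k0 : 0 < n.+1%:R^-1 :> R by rewrite invr_gt0.
have k1 : n.+1%:R^-1 <= 1 :> R by rewrite invf_le1 ?ler1n.
move: (n.+1%:R^-1 : R) nr nl k0 k1 => k kr kl k0 k1.
exists k => // h _ h0 hk ->.
rewrite -[X in (X < _)%E]/(LpN mu p `[h, 1] (lcut u h)).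
have hkU : `[h, 1]%classic = `[h, k]%classic `|` `[k, 1]%classic :> set R.
  apply/seteqP; split=> x; rewrite /= !in_itv/=.
    by case: (leP k x) => kx /andP[hx x1]; [right|left; rewrite hx ltW].
  by case=> /andP[hx x1]; apply/andP; split; lra.
have mh a : h <= a -> measurable_fun `[a, 1] (lcut u h).
  by move=> ha; apply: measurable_lcut; rewrite ?h0.
have leM t : h <= t <= 1 -> (0 <= lcut u h t <= (M + M)%:E)%E.
  move=> /andP[ht t1]; rewrite lcut_ge0 ?h0//=.
  by apply: hausdorff_le_bound; [apply: fcut_nonempty|apply: fcut_nonempty|apply: uM|apply: uM];
    rewrite //; apply/andP; split; lra.
apply: (@le_lt_trans _ _ ((eps / 3)%:E + (eps / 3)%:E)%E); last first.
  by rewrite -EFinD lte_fin; lra.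
have mU : measurable_fun (`[h, k]%classic `|` `[k, 1]%classic) (lcut u h).
  by rewrite -hkU; exact: mh.
have U0 x : (`[h, k]%classic `|` `[k, 1]%classic) x -> (0 <= lcut u h x)%E.
  by rewrite -hkU/= in_itv/= => /leM/andP[].
rewrite hkU; apply: le_trans (@LpN_setU _ _ _ mu p _ _ _ p1
  (measurable_itv _) (measurable_itv _) mU U0) _.
apply: leeD; last first.
  apply: le_trans kl; apply: LpN_le => //.
  - by apply: mh; exact: ltW.
  - by apply: measurable_lcut; rewrite // lexx ltW.
  - move=> t; rewrite /= in_itv/= => /andP[kt t1].
    by rewrite lcut_ge0 ?le_lcut ?h0 ?(ltW hk)//= (le_trans (ltW hk)).
apply: (@le_trans _ _ ((M + M)%:E * ((k - h) `^ p^-1)%:E)%E).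
  apply: LpN_itv_le => //; [exact: ltW|exact: ltW| |].
    apply: measurable_funS (mh h (lexx _)) => //.
    by move=> x; rewrite /= !in_itv/= => /andP[-> xk]; exact: le_trans k1.
  by move=> t /andP[ht tk]; apply: leM; rewrite ht (le_trans tk).
rewrite -EFinM lee_fin mulrC -ler_pdivlMr//.
have -> : eps / 3 / (M + M) = ((eps / 3 / (M + M)) `^ p) `^ p^-1.
  by rewrite -powRrM mulfV ?gt_eqF// powRr1// ltW// divr_gt0.
by apply: ge0_ler_powR; rewrite ?nnegrE ?invr_ge0 ?powR_ge0 ?(ltW p0) ?subr_ge0 ?(ltW hk)//; lra.
Qed.

End left_continuity.

(** Without a finite net, the sets of points missed by finite families form the basis of a proper
    filter; a cluster point [y] contradicts the basis set of points missed by [d y]. *)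
Lemma compact_finite_net (T : topologicalType) (K : set T) (d : T -> set T) :
  compact K -> (forall x, K x -> nbhs x (d x)) ->
  exists s : seq T, (forall x, x \in s -> K x) /\
    forall y, K y -> exists2 x, x \in s & d x y.
Proof.
move=> Kco dK; apply: contrapT => nonet.
pose D := [set s : seq T | forall x, x \in s -> K x].
pose B (s : seq T) := [set y | K y /\ forall x, x \in s -> ~ d x y].
have FF : Filter (filter_from D B).
  apply: filter_from_filter; first by exists [::].
  move=> s t Ds Dt; exists (s ++ t).
    by move=> x; rewrite mem_cat => /orP[/Ds|/Dt].
  by move=> y [Ky sty]; split; split=> // x xs; apply: sty; rewrite mem_cat xs ?orbT.
have PF : ProperFilter (filter_from D B).
  apply: filter_from_proper => s Ds; apply: contrapT => B0.
  apply: nonet; exists s; split=> // y Ky; apply: contrapT => /forall2NP ny.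
  by apply: B0; exists y; split=> // x xs; case: (ny x).
have [|y [Ky cly]] := Kco _ PF.
  by exists [::] => // y [].
have Ds : D [:: y] by move=> x; rewrite inE => /eqP->.
have Bs : filter_from D B (B [:: y]) by exists [:: y].
have [z [[_ yz] dyz]] := cly _ _ Bs (dK _ Ky).
by apply: (yz y); rewrite ?inE.
Qed.

(** * Consequences of compactness *)

Section compact_implies.
Context (R : realType) (m : nat) (p : R) (U : set ('rV[R]_m -> R)).
Hypothesis p1 : 1 <= p.
Hypothesis UFB : U `<=` @FB R m.
Hypothesis Uco : compact (in_dp_space p (@FB R m) U).
Local Notation mu := (@lebesgue_measure R).

Let p0 : 0 < p. Proof. exact: lt_le_trans p1. Qed.

Lemma FB_normal (u : 'rV[R]_m -> R) : FB u -> normal u.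
Proof. by case. Qed.

Lemma FBp_normal (u : 'rV[R]_m -> R) : FBp p u -> normal u.
Proof. by case. Qed.

Lemma compact_dp_net (e : R) : 0 < e ->
  exists s : seq (dp_space p (@FB R m)), (forall v, v \in s -> U (sval v)) /\
    forall u, U u -> exists2 v, v \in s & (dp p (sval v) u < e%:E)%E.
Proof.
move=> e0.
have [|s [sU net]] := compact_finite_net Uco (d := fun v => dp_ball v e).
  by move=> u _; exact (nbhs_dp_ball_self p1 FB_normal u e0).
exists s; split => // u Uu; exact: net (exist _ u (UFB Uu)) Uu.
Qed.

Lemma compact_unif_p_mean_bounded : unif_p_mean_bounded p U.
Proof.
have [s [sU netU]] := compact_dp_net ltr01.
have [M M0 sM] : exists2 M : R, 0 < M &
    forall v, v \in s -> (dp p (sval v) (@hat0 R m) <= M%:E)%E.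
  elim: s {netU} sU => [|v s IH] sU; first by exists 1.
  have [|M M0 sM] := IH; first by move=> w ws; apply: sU; rewrite inE ws orbT.
  have /FBpE[_ _ _ vy] := sub_FB_FBp p1 (svalP v).
  exists (Num.max M (fine (dp p (sval v) (@hat0 R m)))); first by rewrite lt_max M0.
  move=> w; rewrite inE => /predU1P[->|/sM wM].
    by rewrite -[leLHS]fineK ?ge0_fin_numE ?dp_ge0// lee_fin le_max lexx orbT.
  by rewrite (le_trans wM)// lee_fin le_max lexx.
exists (1 + M); first by rewrite addr_gt0.
move=> u Uu; have [v vs vu] := netU u Uu.
have nu : normal u by exact/FB_normal/UFB.
have nv : normal (sval v) by exact/FB_normal/svalP.
apply: le_trans (dp_triangle p1 nu nv (normal_hat0 R m)) _.
by rewrite EFinD; apply: leeD; [rewrite dpC; exact: ltW|exact: sM].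
Qed.

(** The route goes from the cut of [v] at [t] to that of [u] at [t], to that of [u] at [t - h], and
    back to [v]. Translation by [h] turns the last distance into a part of [dp p u v]. *)
Lemma LpN_lcut_le (u v : 'rV[R]_m -> R) (h : R) : normal u -> normal v ->
  0 <= h <= 1 -> (LpN mu p `[h, 1%R] (lcut v h) <=
    dp p u v + LpN mu p `[h, 1%R] (lcut u h) + dp p u v)%E.
Proof.
move=> nu nv /andP[h0 h1].
have h01 t : `[h, 1]%classic t -> (0 <= t <= 1) /\ (0 <= t - h <= 1).
  by rewrite /= in_itv/= => /andP[? ?]; split; apply/andP; split; lra.
have mh : measurable_fun `[h, 1] (hcut u v) by apply: measurable_hcut.
have ms : measurable_fun `[h, 1] (fun t => hcut u v (t - h)).
  apply: (measurable_hausdorff (A := fun t => fcut u (t - h)) (B := fun t => fcut v (t - h))).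
  - by move=> t /andP[ht t1]; apply: fcut_nonempty => //; apply/andP; split; lra.
  - by move=> t /andP[ht t1]; apply: fcut_nonempty => //; apply/andP; split; lra.
  - by move=> s t hs st t1; apply: fcut_anti => //; lra.
  - by move=> s t hs st t1; apply: fcut_anti => //; lra.
have ml w : normal w -> measurable_fun `[h, 1] (lcut w h).
  by move=> nw; apply: measurable_lcut; rewrite // h0 lexx.
have l0 w t : normal w -> `[h, 1]%classic t -> (0 <= lcut w h t)%E.
  by rewrite /= in_itv/= => nw /andP[ht t1]; apply: lcut_ge0; rewrite // h0.
have hh0 t : `[h, 1]%classic t -> (0 <= hcut u v t)%E.
  by move=> /h01[t01 _]; exact: hcut_ge0.
have hs0 t : `[h, 1]%classic t -> (0 <= hcut u v (t - h))%E.
  by move=> /h01[_ t01]; exact: hcut_ge0.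
have le1 : (LpN mu p `[h, 1%R] (hcut u v) <= dp p u v)%E.
  rewrite dpE; apply: LpN_subset => //; first exact: measurable_hcut.
  by move=> t /h01[t01 _]; rewrite /= in_itv.
have le2 : (LpN mu p `[h, 1%R] (fun t => hcut u v (t - h)) <= dp p u v)%E.
  have -> : `[h, 1]%classic = `[0 + h, (1 - h) + h]%classic :> set R.
    by rewrite add0r subrK.
  have m1h : measurable_fun `[0, 1 - h] (hcut u v).
    by apply: measurable_hcut => //; lra.
  rewrite LpN_shift//; last first.
    move=> t; rewrite /= in_itv/= => /andP[? ?].
    by apply: hcut_ge0 => //; apply/andP; split; lra.
  rewrite dpE; apply: LpN_subset => //; first exact: measurable_hcut.
  by move=> t; rewrite /= !in_itv/= => /andP[? ?]; apply/andP; split; lra.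
apply: le_trans (leeD (leeD le1 (lexx _)) le2).
pose f t := (hcut u v t + lcut u h t)%E.
have mf : measurable_fun `[h, 1] f by apply: emeasurable_funD => //; exact: ml.
have f0 t : `[h, 1]%classic t -> (0 <= f t)%E.
  by move=> ht; rewrite adde_ge0 ?hh0 ?l0.
apply: (@le_trans _ _ (LpN mu p `[h, 1%R] f + LpN mu p `[h, 1%R] (fun t => hcut u v (t - h)))%E).
  apply: LpN_triangle => //; first exact: ml.
  move=> t ht; rewrite l0//=; have [t01 th01] := h01 t ht.
  apply: (@le_trans _ _ (hcut v u t + (lcut u h t + hcut u v (t - h)))%E).
    apply: le_trans (hausdorff_triangle (B := fcut u t) _ _ _) _; try exact: fcut_nonempty.
    rewrite leeD2l//; apply: hausdorff_triangle; exact: fcut_nonempty.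
  by rewrite hcutC addeA.
rewrite leeD2r//; apply: LpN_triangle => //; first exact: ml.
- by move=> t; exact: l0.
- by move=> t ht; rewrite f0//=.
Qed.

Lemma compact_equi_left_continuous : p_mean_equi_left_continuous p U.
Proof.
move=> eps eps0; have e0 : 0 < eps / 3 by rewrite divr_gt0.
have [s [sU netU]] := compact_dp_net e0.
have [d d0 sd] : exists2 d : R, 0 < d <= 1 & forall v, v \in s ->
    forall h, 0 <= h -> h < d -> (LpN mu p `[h, 1%R] (lcut (sval v) h) < (eps / 3)%:E)%E.
  elim: s {netU} sU => [|v s IH] sU; first by exists 1; rewrite // ltr01 lexx.
  have [|d /andP[d0 d1] sd] := IH.
    by move=> w ws; apply: sU; rewrite inE ws orbT.
  have [r r0 vr] := FB_equi_left_continuous p1 (svalP v) e0.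
  exists (Num.min d r); first by rewrite lt_min d0 r0 ge_min d1.
  move=> w; rewrite inE => /predU1P[->|ws] h h0; rewrite lt_min => /andP[hd hr].
    exact: vr.
  exact: sd.
have /andP[d00 d1] := d0; exists d => // h u h0 hd Uu.
have [v vs vu] := netU u Uu.
rewrite -[X in (X < _)%E]/(LpN mu p `[h, 1%R] (lcut u h)).
have nu : normal u by exact/FB_normal/UFB.
have nv : normal (sval v) by exact/FB_normal/svalP.
apply: le_lt_trans (LpN_lcut_le nv nu _) _.
  by rewrite h0 (le_trans (ltW hd)).
have -> : eps = eps / 3 + eps / 3 + eps / 3 by lra.
rewrite !EFinD; apply: lteD; last exact: vu.
by apply: lteD; [exact: vu|exact: sd].
Qed.

(** A point [w] of the closure lies in [FBp p], whereas compactness concerns filters on [FB]. The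
    members of [U] close to [w] generate a filter there; its cluster point [u] satisfies
    [dp p w u = 0], so [w = u]. *)
Lemma compact_closed_dp :
  closure (in_dp_space p (@FBp R m p) U) = in_dp_space p (@FBp R m p) U.
Proof.
apply/seteqP; split; last exact: subset_closure.
move=> w clw.
pose B (r : R) := [set u : dp_space p (@FB R m) |
  U (sval u) /\ (dp p (sval w) (sval u) < r%:E)%E].
have FF : Filter (filter_from [set r : R | 0 < r] B).
  apply: filter_from_filter; first by exists 1; exact: ltr01.
  move=> r s /= r0 s0; exists (Num.min r s); first by rewrite /= lt_min r0.
  by move=> u [Uu wu]; split; split=> //; apply: (lt_le_trans wu);
    rewrite lee_fin ge_min lexx ?orbT.
have PF : ProperFilter (filter_from [set r : R | 0 < r] B).
  apply: filter_from_proper => r /= r0.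
  have [v [Uv wv]] := clw _ (nbhs_dp_ball_self p1 FBp_normal w r0).
  by exists (exist _ (sval v) (UFB Uv)).
have [|u [Uu clu]] := Uco PF.
  by exists 1; [exact: ltr01|move=> u []].
have FBu := sub_FB_FBp p1 (svalP u).
suff wu : sval w = sval u by rewrite /in_dp_space/= wu.
apply: (dp_eq0 p1 (svalP w) FBu).
apply/le_anti/andP; split; last exact: dp_ge0.
apply/lee_addgt0Pr => e e0; rewrite add0e.
have e20 : 0 < e / 2 by rewrite divr_gt0.
have Be : filter_from [set r : R | 0 < r] B (B (e / 2)) by exists (e / 2).
have [v [[_ wv] uv]] := clu _ _ Be (nbhs_dp_ball_self p1 FB_normal u e20).
apply: le_trans (dp_triangle p1 (FBp_normal (svalP w)) (FB_normal (svalP v))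
  (FB_normal (svalP u))) _.
have -> : e = e / 2 + e / 2 by lra.
have {}uv : (dp p (sval v) (sval u) <= (e / 2)%:E)%E by rewrite dpC; exact: ltW.
by rewrite EFinD; exact: leeD (ltW wv) uv.
Qed.

End compact_implies.

(** * Total boundedness *)

Section total_boundedness.
Context (R : realType) (m : nat) (p : R).
Hypothesis p1 : 1 <= p.
Implicit Types (u v w : 'rV[R]_m -> R) (a b h : R).
Local Notation mu := (@lebesgue_measure R).

Let p0 : 0 < p. Proof. exact: lt_le_trans p1. Qed.

(* Equi-left-continuity bounds the cuts near level [0] by the cuts at levels in
   [[h, h + k]], where p-mean boundedness bounds them uniformly. *)
Lemma LpN_hcut_hat0_le u h k (M e : R) : normal u -> 0 < h -> 0 < k -> h + k <= 1 ->
  (dp p u (@hat0 R m) <= M%:E)%E -> (LpN mu p `[h, 1%R] (lcut u h) <= e%:E)%E ->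
  (LpN mu p `[0%R, k] (hcut u (@hat0 R m)) <=
    (e + M / h `^ p^-1 * k `^ p^-1)%:E)%E.
Proof.
move=> nu h0 k0 hk uM ue; have nz := normal_hat0 R m.
have M0 : 0 <= M by rewrite -lee_fin (le_trans (dp_ge0 _ _ _) uM).
have hk1 : h <= 1 by lra.
have mk : measurable_fun `[0, k] (hcut u (@hat0 R m)).
  by apply: measurable_hcut => //; lra.
have k01 t : `[0, k]%classic t -> (0 <= hcut u (@hat0 R m) t)%E.
  by rewrite /= in_itv/= => /andP[? ?]; apply: hcut_ge0 => //; apply/andP; split; lra.
rewrite -(LpN_shift p h mk k01) add0r.
have ml : measurable_fun `[h, k + h] (lcut u h).
  apply: (@measurable_funS _ _ _ _ `[h, 1]) => //; last first.
    by apply: measurable_lcut; rewrite // (ltW h0)/=.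
  by move=> t; rewrite /= !in_itv/= => /andP[? ?]; apply/andP; split; lra.
have mh : measurable_fun `[h, k + h] (hcut u (@hat0 R m)).
  by apply: measurable_hcut => //; lra.
have ms : measurable_fun `[h, k + h] (fun t => hcut u (@hat0 R m) (t - h)).
  apply: (measurable_hausdorff (A := fun t => fcut u (t - h)) (B := fun t => fcut (@hat0 R m) (t - h))).
  - by move=> t /andP[? ?]; apply: fcut_nonempty => //; apply/andP; split; lra.
  - by move=> t /andP[? ?]; apply: fcut_nonempty => //; apply/andP; split; lra.
  - by move=> s t ? ? ?; apply: fcut_anti => //; lra.
  - by move=> s t ? ? ?; apply: fcut_anti => //; lra.
apply: (@le_trans _ _ (LpN mu p `[h, (k + h)%R] (lcut u h) +
    LpN mu p `[h, (k + h)%R] (hcut u (@hat0 R m)))%E).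
  apply: LpN_triangle => // t; rewrite /= in_itv/= => /andP[ht tk].
  - by apply: lcut_ge0 => //; [rewrite (ltW h0)|lra].
  - by apply: hcut_ge0 => //; apply/andP; split; lra.
  - rewrite hcut_ge0//=; last by apply/andP; split; lra.
    have th01 : 0 <= t - h <= 1 by apply/andP; split; lra.
    have t01 : 0 <= t <= 1 by apply/andP; split; lra.
    rewrite !hcut_hat0//.
    rewrite /lcut (hausdorffC (fcut u t)).
    apply: hausdorff_triangle; [exact: fcut_nonempty|exact: fcut_nonempty|].
    by exists 0.
rewrite EFinD; apply: leeD.
  apply: le_trans ue; apply: LpN_subset => //.
    by apply: measurable_lcut; rewrite // (ltW h0)/=.
  by move=> t; rewrite /= !in_itv/= => /andP[? ?]; apply/andP; split; lra.
have Mh : 0 <= M / h `^ p^-1 by rewrite divr_ge0 ?powR_ge0.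
have hkh : h <= k + h by lra.
have := LpN_itv_le p1 hkh Mh mh; rewrite addrK -EFinM; apply => t /andP[ht tk].
have t01 : 0 <= t <= 1 by apply/andP; split; lra.
apply/andP; split; first exact: hcut_ge0.
rewrite hcut_hat0//; apply/hausdorff_le_set0; first exact: fcut_nonempty.
move=> x ux; rewrite lee_fin; apply: (dp_hat0_fcut p1 nu _ uM); first by rewrite h0.
by apply: fcut_anti ux => //; exact: ltW.
Qed.

(** Net points are given by index, so that ['I_(size s)] can serve as a finite type below. *)
Lemma bounded_finite_net (C e : R) : 0 < e -> exists s : seq 'rV[R]_m,
  forall x : 'rV[R]_m, edist x 0 <= C -> exists2 i, (i < size s)%N & edist x (nth 0 s i) < e.
Proof.
move=> e0; pose K := [set x : 'rV[R]_m | edist x 0 <= C].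
have Kc : compact K.
  apply: bounded_closed_compact; first exact: (@bounded_set_edist _ _ _ C).
  move=> x clx; rewrite /K/= leNgt; apply/negP => xC.
  have r0 : 0 < edist x 0 - C by rewrite subr_gt0.
  have [y [Ky xy]] := clx _ (near_edist x r0).
  rewrite /K/= in Ky; have := edist_triangle y x 0; lra.
have [|s [_ net]] := compact_finite_net Kc (d := fun x => [set y | edist x y < e]).
  by move=> x _; exact: near_edist.
exists s => x /net[y ys yx]; exists (index y s); first by rewrite index_mem.
by rewrite nth_index// edistC.
Qed.

(** An ultrafilter decides each [S i], and finitely many decisions can be intersected. This plays
    the part of the pigeonhole principle. *)
Lemma ultra_finite_pattern (T : Type) (F : set_system T) (I : finType)
    (S : I -> set T) : UltraFilter F ->
  exists2 A, F A & forall x y, A x -> A y -> forall i, S i x -> S i y.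
Proof.
move=> FU; pose P i : set T := if pselect (F (S i)) then S i else ~` S i.
have FP i : F (P i).
  rewrite /P; case: pselect => // nF.
  by case: (in_ultra_setVsetC (S i) FU).
exists [set x | forall i, P i x]; first exact: filter_forall.
by move=> x y Px Py i; move: (Px i) (Py i); rewrite /P; case: pselect.
Qed.

(** The last grid level [g = k * h] up to [t] satisfies [t - h < g <= t], so by nestedness passing
    from [t] to [g] costs at most [lcut]. The condition [h <= k * h] leaves out level 0, where a
    p-mean bound gives no common ball. *)
Lemma hcut_le_lcut u v h t (c : R) : normal u -> normal v -> 0 < h -> h <= t -> t <= 1 ->
  (forall k : nat, h <= k%:R * h -> k%:R * h <= 1 -> (hcut u v (k%:R * h) <= c%:E)%E) ->
  (hcut u v t <= lcut u h t + (c%:E + lcut v h t))%E.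
Proof.
move=> nu nv h0 ht t1 uvc.
have th0 : 0 <= t / h by rewrite divr_ge0 ?ltW//; lra.
have := trunc_itv th0; move: (Num.trunc _) => k /andP[kt tk].
rewrite ler_pdivlMr// in kt; rewrite ltr_pdivrMr// -natr1 mulrDl mul1r in tk.
have k1 : (1 <= k)%N.
  rewrite lt0n; apply/eqP => k0; move: tk; rewrite k0 mul0r; lra.
have hk : h <= k%:R * h by rewrite (ler_peMl (ltW h0))// ler1n.
set g := k%:R * h in kt tk hk.
have gb : 0 <= g <= 1 by apply/andP; split; lra.
have tb : 0 <= t <= 1 by apply/andP; split; lra.
have thb : 0 <= t - h <= 1 by apply/andP; split; lra.
have cl w : normal w -> (hausdorff_dist (fcut w t) (fcut w g) <= lcut w h t)%E.
  move=> nw; apply: hausdorff_le_nested; try exact: fcut_nonempty.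
    by apply: fcut_anti; lra.
  by apply: fcut_anti; lra.
apply: le_trans (hausdorff_triangle (B := fcut u g) _ _ _) _; try exact: fcut_nonempty.
apply: leeD; first exact: cl.
apply: le_trans (hausdorff_triangle (B := fcut v g) _ _ _) _; try exact: fcut_nonempty.
apply: leeD; first by apply: uvc => //; exact: le_trans kt t1.
by rewrite hausdorffC; exact: cl.
Qed.

Lemma ultra_dp_cauchy (X U : set ('rV[R]_m -> R)) (F : set_system (dp_space p X)) :
  UltraFilter F -> F (in_dp_space p X U) -> (forall u, U u -> normal u) ->
  unif_p_mean_bounded p U -> p_mean_equi_left_continuous p U ->
  forall e : R, 0 < e -> exists A : set (dp_space p X),
    [/\ F A, A `<=` in_dp_space p X U &
      forall u v : dp_space p X, A u -> A v -> (dp p (sval u) (sval v) <= e%:E)%E].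
Proof.
move=> FU FUU Unormal [M M0 UM] Ueq eps eps0.
(* Levels below [h] will cost [4 * e], two for each fuzzy set; those above will cost [3 * e], two
   left shifts and one grid comparison. *)
pose e := eps / 7; have e0 : 0 < e by rewrite divr_gt0.
have [d d0 Ud] := Ueq e e0.
have lcutU h u : 0 <= h -> h < d -> U u -> (LpN mu p `[h, 1%R] (lcut u h) <= e%:E)%E.
  by move=> h0 hd Uu; apply: ltW; exact: Ud.
(* Below [d], so that shifts by [h0] are controlled, and at most [1 / 2], so that [h0 + h <= 1]. *)
pose h0 := Num.min (d / 2) (1 / 2).
have h00 : 0 < h0 by rewrite lt_min !divr_gt0.
have h0d : h0 < d by rewrite gt_min; apply/orP; left; lra.
have h01 : h0 <= 1 / 2 by rewrite ge_min lexx orbT.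
(* Solves [M / h0^(1/p) * c^(1/p) = e], so that [h <= c] keeps the second term of [LpN_hcut_hat0_le]
   at most [e]. *)
pose c := (e * h0 `^ p^-1 / M) `^ p.
have c0 : 0 < c by rewrite powR_gt0// divr_gt0// mulr_gt0// powR_gt0.
pose h := Num.min h0 c.
have hgt0 : 0 < h by rewrite lt_min h00.
have hh0 : h <= h0 by rewrite ge_min lexx.
have hc : h <= c by rewrite ge_min lexx orbT.
have tail u : U u -> (LpN mu p `[0%R, h] (hcut u (@hat0 R m)) <= (e + e)%:E)%E.
  move=> Uu; apply: (le_trans (@LpN_hcut_hat0_le u h0 h M e _ h00 hgt0 _ (UM u Uu) _)).
  - exact: Unormal.
  - by lra.
  - by apply: lcutU => //; exact: ltW.
  rewrite lee_fin lerD2l.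
  have hpc : h `^ p^-1 <= e * h0 `^ p^-1 / M.
    have -> : e * h0 `^ p^-1 / M = c `^ p^-1.
      rewrite /c -powRrM mulfV ?gt_eqF// powRr1// divr_ge0// ?mulr_ge0 ?powR_ge0 ?ltW//.
    by apply: ge0_ler_powR; rewrite ?nnegrE ?invr_ge0 ?(ltW p0) ?(ltW hgt0) ?(ltW c0).
  apply: le_trans (ler_wpM2l _ hpc) _; first by rewrite divr_ge0 ?powR_ge0 ?ltW.
  rewrite le_eqVlt; apply/orP; left; apply/eqP; field.
  by rewrite !gt_eqF ?powR_gt0.
have [s sC] := bounded_finite_net (M / h `^ p^-1) (divr_gt0 e0 (ltr0Sn R 1)).
(* Every [k] with [k * h <= 1] is smaller than [N]. *)
pose N := (Num.trunc h^-1).+1.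
(* Whether the cut at level [k * h] meets the ball of radius [e / 2] around the [i]-th net point.
   Members of [U] with the same answers have cuts within [e] of each other at all grid levels in
   [[h, 1]]. *)
pose S (ki : 'I_N * 'I_(size s)) : set (dp_space p X) :=
  [set u | exists2 x, fcut (sval u) (ki.1%:R * h) x & edist x (nth 0 s ki.2) < e / 2].
have [B FB SB] := ultra_finite_pattern S FU.
exists (B `&` in_dp_space p X U); split; [exact: filterI|by move=> u []|].
move=> u v [Bu Uu] [Bv Uv]; rewrite /in_dp_space/= in Uu Uv.
have nu := Unormal _ Uu; have nv := Unormal _ Uv; have nz := normal_hat0 R m.
have grid (w z : dp_space p X) : B w -> B z -> U (sval w) -> U (sval z) ->
    forall k : nat, h <= k%:R * h -> k%:R * h <= 1 ->
    forall x, fcut (sval w) (k%:R * h) x ->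
    exists2 y, fcut (sval z) (k%:R * h) y & edist x y <= e.
  move=> Bw Bz Uw Uz k hk k1 a wa.
  have kN : (k < N)%N.
    have hV : 0 <= h^-1 by rewrite invr_ge0 ltW.
    have /andP[_ hN] := trunc_itv hV.
    rewrite -(ltr_nat R); apply: le_lt_trans hN.
    by rewrite -ler_pdivlMr// div1r in k1.
  have h01' : 0 < h <= 1 by rewrite hgt0; lra.
  have wh : fcut (sval w) h a by apply: fcut_anti wa => //; exact: ltW.
  have [i si ai] := sC a (dp_hat0_fcut p1 (Unormal _ Uw) h01' (UM _ Uw) wh).
  have [|b zb bi] := SB w z Bw Bz (Ordinal kN, Ordinal si); first by exists a.
  exists b => //; apply: le_trans (edist_triangle (nth 0 s i) _ _) _.
  rewrite (edistC _ b); move: ai bi; rewrite /=; lra.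
have gridc k : h <= k%:R * h -> k%:R * h <= 1 ->
    (hcut (sval u) (sval v) (k%:R * h) <= e%:E)%E.
  move=> hk k1; have kb : 0 <= k%:R * h <= 1 by apply/andP; split; lra.
  apply: hausdorff_le_fin; [exact: fcut_nonempty|exact: fcut_nonempty| |].
    exact: grid.
  exact: grid.
have h1 : h <= 1 by lra.
have UU : `[0, 1]%classic = `[0, h]%classic `|` `[h, 1]%classic :> set R.
  apply/seteqP; split=> t; rewrite /= !in_itv/=.
    by case: (leP h t) => ? /andP[? ?]; [right|left]; apply/andP; split; lra.
  by case=> /andP[? ?]; apply/andP; split; lra.
have mU : measurable_fun (`[0, h]%classic `|` `[h, 1]%classic : set R) (hcut (sval u) (sval v)).
  by rewrite -UU; exact: measurable_hcut.
have U0 t : (`[0, h]%classic `|` `[h, 1]%classic) t -> (0 <= hcut (sval u) (sval v) t)%E.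
  by rewrite -UU => /in01 t01; exact: hcut_ge0.
rewrite dpE UU.
apply: le_trans (@LpN_setU _ _ _ mu p _ _ _ p1 (measurable_itv _) (measurable_itv _) mU U0) _.
have low : (LpN mu p `[0%R, h] (hcut (sval u) (sval v)) <= ((e + e) + (e + e))%:E)%E.
  rewrite EFinD; apply: le_trans (leeD (tail _ Uu) (tail _ Uv)).
  have b01 t : `[0, h]%classic t -> 0 <= t <= 1.
    by rewrite /= in_itv/= => /andP[? ?]; apply/andP; split; lra.
  apply: LpN_triangle => //; try exact: measurable_hcut.
  - by move=> t /b01 ?; exact: hcut_ge0.
  - by move=> t /b01 ?; exact: hcut_ge0.
  - move=> t /b01 t01; rewrite hcut_ge0//=; rewrite (hcutC (sval v)).
    exact: hcut_triangle.
have high : (LpN mu p `[h, 1%R] (hcut (sval u) (sval v)) <= (e + (e + e))%:E)%E.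
  have ml w : normal w -> measurable_fun `[h, 1] (lcut w h).
    by move=> nw; apply: measurable_lcut; rewrite // (ltW hgt0)/=.
  have l0 w t : normal w -> `[h, 1]%classic t -> (0 <= lcut w h t)%E.
    by rewrite /= in_itv/= => nw /andP[ht t1]; apply: lcut_ge0; rewrite // (ltW hgt0).
  have mcst : measurable_fun (`[h, 1]%classic : set R) (cst e%:E) by exact: measurable_cst.
  pose f t := (e%:E + lcut (sval v) h t)%E.
  have mf : measurable_fun `[h, 1] f by apply: emeasurable_funD => //; exact: ml.
  have f0 t : `[h, 1]%classic t -> (0 <= f t)%E.
    by move=> ht; rewrite adde_ge0 ?l0// lee_fin ltW.
  apply: (@le_trans _ _ (LpN mu p `[h, 1%R] (lcut (sval u) h) + LpN mu p `[h, 1%R] f)%E).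
    apply: LpN_triangle => //; [exact: ml|apply: measurable_hcut => //; exact: ltW|by move=> t; exact: l0|].
    move=> t; rewrite /= in_itv/= => /andP[ht t1].
    rewrite hcut_ge0//=; first exact: hcut_le_lcut.
    by apply/andP; split; lra.
  have hd : h < d by lra.
  rewrite EFinD; apply: leeD; first by apply: lcutU => //; exact: ltW.
  apply: (@le_trans _ _ (LpN mu p `[h, 1%R] (cst e%:E) + LpN mu p `[h, 1%R] (lcut (sval v) h))%E).
    apply: LpN_triangle => //; [exact: ml|by move=> t _; rewrite lee_fin ltW|by move=> t; exact: l0|].
    by move=> t ht; rewrite f0/=.
  rewrite EFinD; apply: leeD; last by apply: lcutU => //; exact: ltW.
  have := LpN_itv_le p1 h1 (ltW e0) mcst; set z := LpN _ _ _ _ => H.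
  apply: le_trans (H _) _; first by move=> t _; rewrite lee_fin ltW//= lexx.
  rewrite -EFinM lee_fin ger_pMr//.
  apply: (@le_trans _ _ (1 `^ p^-1)); last by rewrite powR1.
  by apply: ge0_ler_powR; rewrite ?nnegrE ?invr_ge0 ?(ltW p0)//; lra.
apply: le_trans (leeD low high) _; rewrite -EFinD lee_fin /e; lra.
Qed.

End total_boundedness.

(** * Completeness *)

Section set_limit.
Context (R : realType) (m : nat).
Implicit Types (x y : 'rV[R]_m) (A : nat -> set 'rV[R]_m) (e : nat -> R).

(** For nonempty sets, the Kuratowski lower limit. It makes sense without convergence and respects
    inclusion. *)
Definition set_lim A : set 'rV[R]_m :=
  [set x | forall e : R, 0 < e -> \forall n \near \oo, dset (A n) x < e].

Lemma closed_set_lim A : (forall n, A n !=set0) -> closed (set_lim A).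
Proof.
move=> A0 x clx e e0; have e20 : 0 < e / 2 by rewrite divr_gt0.
have [y [Ay xy]] := clx _ (near_edist x e20).
apply: filterS (Ay _ e20) => n yn.
by have := dset_lipschitz x y (A0 n); lra.
Qed.

Lemma set_lim_anti A B : (forall n, B n !=set0) -> (forall n, B n `<=` A n) ->
  set_lim B `<=` set_lim A.
Proof.
move=> B0 BA x Bx e /Bx; apply: filterS => n; apply: le_lt_trans.
exact: dset_anti.
Qed.

(* Pointwise limits of distance functions of sets are distance functions, by
   local compactness: nearly optimal points of [A k] cluster in [set_lim A]. *)
Lemma set_lim_dist A e : (forall n, A n !=set0) ->
  (forall d : R, 0 < d -> \forall n \near \oo, e n < d) ->
  (forall n k, (n <= k)%N -> forall x, `|dset (A n) x - dset (A k) x| <= e n) ->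
  forall n x, (exists2 y, set_lim A y & edist x y <= dset (A n) x + e n) /\
    forall y, set_lim A y -> dset (A n) y <= e n.
Proof.
move=> A0 e0 Acauchy n x; split; last first.
  move=> y Ay; apply/ler_addgt0Pr => d d0.
  have [k [/= nk yk]] := filter_ex (filterI (nbhs_infty_ge n) (Ay _ d0)).
  by have := Acauchy n k nk y; rewrite ler_norml => /andP[]; lra.
have /choice[y_ yA] : forall k, exists y, A k y /\ edist x y < dset (A k) x + k.+1%:R^-1.
  move=> k; have k0 : 0 < k.+1%:R^-1 :> R by rewrite invr_gt0.
  by have [y Ay xy] := dset_adherent x (A0 k) k0; exists y.
have xle k : (n <= k)%N -> edist x (y_ k) <= dset (A n) x + e n + k.+1%:R^-1.
  move=> nk; have [_ xy] := yA k; have := Acauchy n k nk x.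
  move: xy; rewrite ler_norml; move: (k.+1%:R^-1 : R) => z xz /andP[? ?]; lra.
have inv1 k : k.+1%:R^-1 <= 1 :> R by rewrite invf_le1 ?ler1n.
pose K := closure [set y_ k | k in [set k | (n <= k)%N]].
have Kc : compact K.
  apply: bounded_closed_compact; last exact: closed_closure.
  apply: (@bounded_set_edist _ _ _ (edist x 0 + (dset (A n) x + e n + 1) + 1)) => z Kz.
  have [_ [/= [k nk <-] zy]] := Kz _ (near_edist z ltr01).
  have := edist_triangle x z 0; have := edist_triangle (y_ k) z x.
  rewrite (edistC (y_ k) x); have := xle k nk; have := inv1 k.
  move: (k.+1%:R^-1 : R) => *; lra.
have PF : ProperFilter (y_ @ \oo) by exact: fmap_proper_filter.
have [|y [Ky cly]] := Kc _ PF.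
  apply: filterS (nbhs_infty_ge n) => k nk; apply: subset_closure.
  by exists k.
have freq (P : set nat) (d : R) : 0 < d -> (\forall k \near \oo, P k) ->
    exists2 k, P k & edist y (y_ k) < d.
  move=> d0 nP.
  have yP : (y_ @ \oo) [set y_ k | k in P].
    by apply: filterS nP => k Pk; exists k.
  by have [_ [[k Pk <-] yk]] := cly _ _ yP (near_edist y d0); exists k.
exists y.
  (* Some [y_ k] with [k >= N] is close to [y], so [dset (A k) y] is small; the Cauchy bound carries
     this over to every [j >= N]. *)
  move=> d d0; have d4 : 0 < d / 4 by rewrite divr_gt0.
  have [N [Ne _]] := filter_ex (filterI (e0 _ d4) (nbhs_infty_ge 0)).
  have [k /= Nk yk] := freq _ _ d4 (nbhs_infty_ge N).
  apply: filterS (nbhs_infty_ge N) => j /= Nj.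
  have := Acauchy N k Nk y; have := Acauchy N j Nj y.
  have := dset_le y (yA k).1; rewrite !ler_norml => ? /andP[? ?] /andP[? ?].
  lra.
apply/ler_addgt0Pr => d d0; have d2 : 0 < d / 2 by rewrite divr_gt0.
have [k [/= kd nk] yk] := freq _ _ d2 (filterI (near_infty_natSinv_lt (PosNum d2)) (nbhs_infty_ge n)).
have := edist_triangle (y_ k) x y; rewrite (edistC (y_ k) y).
have := xle k nk; move: (k.+1%:R^-1 : R) kd => *; lra.
Qed.

Lemma hausdorff_set_lim A e : (forall n, A n !=set0) ->
  (forall d : R, 0 < d -> \forall n \near \oo, e n < d) ->
  (forall n k, (n <= k)%N -> forall x, `|dset (A n) x - dset (A k) x| <= e n) ->
  set_lim A !=set0 /\
  forall n, (hausdorff_dist (A n) (set_lim A) <= (e n)%:E)%E.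
Proof.
move=> A0 e0 Ac; have H := set_lim_dist A0 e0 Ac.
have K0 : set_lim A !=set0 by have [[y Ky _] _] := H 0%N 0; exists y.
split=> // n; apply/hausdorff_leP => // x; rewrite lee_fin.
have [[y Ky xy] HK] := H n x.
rewrite ler_norml; apply/andP; split.
  by have := dset_le x Ky; lra.
rewrite lerBlDr -lerBlDl; apply: dset_ge => // z Kz.
by have := HK z Kz; have := dset_lipschitz x z (A0 n); lra.
Qed.

Lemma hausdorff_set_lim_geometric A (C : R) : 0 <= C -> (forall n, A n !=set0) ->
  (forall n, (hausdorff_dist (A n) (A n.+1) <= (C / 2 ^+ n)%:E)%E) ->
  set_lim A !=set0 /\
  forall n, (hausdorff_dist (A n) (set_lim A) <= (2 / 2 ^+ n * C)%:E)%E.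
Proof.
move=> C0 A0 AC.
have half n : 2 ^+ n != 0 :> R by rewrite expf_neq0.
apply: (hausdorff_set_lim (e := fun n => 2 / 2 ^+ n * C)) => //.
- move=> d d0; have C1 : 0 < C + 1 by rewrite ltr_wpDl.
  have r0 : 0 < d / (2 * (C + 1)) by rewrite divr_gt0// mulr_gt0.
  have := near_infty_natSinv_expn_lt (PosNum r0); apply: filterS => n /=.
  move=> nd; apply: (@le_lt_trans _ _ (2 * (C + 1) * (1 / 2 ^+ n))).
    rewrite mulrAC mulrA mulr1 ler_wpM2r ?invr_ge0 ?exprn_ge0//; lra.
  by rewrite mulrC -ltr_pdivlMr// mulr_gt0.
(* The exact geometric sum from [n] to [k - 1] is the form that passes through the induction. *)
- move=> n k nk x; suff : `|dset (A n) x - dset (A k) x| <= 2 * C * ((2 ^+ n)^-1 - (2 ^+ k)^-1).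
    move/le_trans; apply; have : 0 <= 2 * C * (2 ^+ k)^-1 by rewrite !mulr_ge0// invr_ge0 exprn_ge0.
    lra.
  rewrite -(subnKC nk); elim: (k - n)%N => [|j IH].
    by rewrite addn0 !subrr normr0 mulr0.
  have := dset_le_hausdorff x (A0 (n + j)%N) (A0 (n + j).+1).
  move/le_trans => /(_ _ (AC (n + j)%N)); rewrite lee_fin => H.
  rewrite addnS; apply: le_trans (ler_distD (dset (A (n + j)%N) x) _ _) _.
  apply: le_trans (lerD IH H) _; rewrite exprS invfM; lra.
Qed.

End set_limit.

(** * Fuzzy sets built from a nested family of cuts *)

Section limit_fuzzy_set.
Context (R : realType) (m : nat).
Variable K : R -> set 'rV[R]_m.
Hypothesis Kanti : forall a b, 0 < a -> a <= b -> b <= 1 -> K b `<=` K a.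
Hypothesis Kclosed : forall a, 0 < a <= 1 -> closed (K a).

(** Adjoining 0 keeps the set nonempty and gives the value 0 to points outside every [K a]. *)
Definition level_fun (x : 'rV[R]_m) : R :=
  sup ([set 0] `|` [set a | 0 < a <= 1 /\ K a x]).

Let has_sup_level x : has_sup ([set 0] `|` [set a | 0 < a <= 1 /\ K a x]).
Proof.
split; first by exists 0; left.
by exists 1 => a [->|[/andP[_ a1] _]].
Qed.

Lemma level_fun_ge0 x : 0 <= level_fun x.
Proof. by apply: sup_upper_bound => //; left. Qed.

Lemma level_fun_ge a x : 0 < a <= 1 -> K a x -> a <= level_fun x.
Proof. by move=> a01 Kx; apply: sup_upper_bound => //; right. Qed.

Lemma fuzzy_level_fun : fuzzy level_fun.
Proof.
move=> x; rewrite level_fun_ge0/=; apply: ge_sup; first by exists 0; left.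
by move=> a [->|[/andP[_ a1] _]].
Qed.

(** Strict inequality, because the supremum need not be attained: where [K] is not left-continuous,
    the cut is larger than [K a]. *)
Lemma le_level_funP a x : 0 < a <= 1 ->
  a <= level_fun x <-> forall b, 0 < b < a -> K b x.
Proof.
move=> /andP[a0 a1]; split=> [ax b /andP[b0 ba]|aK].
  have d0 : 0 < level_fun x - b by rewrite subr_gt0 (lt_le_trans ba).
  have [c [->|[/andP[c0 c1] Kc]]] := sup_adherent d0 (has_sup_level x).
    by rewrite -/(level_fun x); lra.
  by rewrite -/(level_fun x) => bc; apply: Kanti Kc => //; lra.
rewrite leNgt; apply/negP => xa; have x0 := level_fun_ge0 x.
pose b := (level_fun x + a) / 2.
have b01 : 0 < b <= 1 by rewrite /b; apply/andP; split; lra.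
have : b <= level_fun x.
  by apply: level_fun_ge => //; apply: aK; rewrite /b; apply/andP; split; lra.
by rewrite /b; lra.
Qed.

Lemma upper_semicontinuous_level_fun : upper_semicontinuous level_fun.
Proof.
move=> x a xa; have [a1|a1] := ltP 1 a.
  apply/near_edistP; exists 1 => // y _.
  by have /andP[_ y1] := fuzzy_level_fun y; exact: le_lt_trans a1.
have a01 : 0 < a <= 1 by rewrite a1 (le_lt_trans (level_fun_ge0 x)).
have [b [b0a Kb]] : exists b, 0 < b < a /\ ~ K b x.
  apply: contrapT => /forallNP nb.
  have : a <= level_fun x.
    by apply/le_level_funP => // b b0a; apply: contrapT => nK; exact: (nb b).
  by rewrite leNgt xa.
have Kcl : closed (K b).
  by apply: Kclosed; have /andP[? ?] := b0a; apply/andP; split; lra.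
have /near_edistP[e e0 xe] : \forall y \near x, ~ K b y.
  by apply: open_nbhs_nbhs; split => //; rewrite openC.
apply/near_edistP; exists e => // y /xe Ky; rewrite ltNge; apply/negP => /(le_level_funP _ a01).1.
by move=> /(_ _ b0a).
Qed.

(** [K 1] may be empty, so a point of value 1 is obtained as a common point of the sets [K (1 - h)].
    A compact bound at one level [r] covers all higher levels. *)
Lemma normal_level_fun (r : R) (C : set 'rV[R]_m) : compact C -> 0 < r < 1 ->
  K r `<=` C -> (forall a, 0 < a < 1 -> K a !=set0) -> normal level_fun.
Proof.
move=> Cc /andP[r0 r1] KC K0; have r10 : 0 < 1 - r by lra.
have [||||x Kx] := @nested_compact R _ C (1 - r) (fun h => K (1 - h)) Cc r10.
- by move=> h /andP[? ?]; apply: K0; apply/andP; split; lra.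
- by move=> h /andP[? ?]; apply: Kclosed; apply/andP; split; lra.
- by move=> h /andP[? ?]; apply: subset_trans KC; apply: Kanti; lra.
- by move=> h k ? ? ?; apply: Kanti; lra.
exists x; apply/le_anti/andP; split; first by have /andP[] := fuzzy_level_fun x.
have h1 : 0 < (1 : R) <= 1 by rewrite ltr01 lexx.
apply/(le_level_funP _ h1) => b /andP[b0 b1].
have [br|rb] := leP b r.
  have hr : 0 < 1 - r <= 1 - r by rewrite r10 lexx.
  by apply: Kanti (Kx _ hr) => //; lra.
have hb : 0 < 1 - b <= 1 - r by apply/andP; split; lra.
by apply: Kanti (Kx _ hb) => //; lra.
Qed.

(* A level where the cut of [level_fun] differs from [K] is the last level at
   which [K] meets some ball with rational centre and radius [1 / j]. *)
Lemma fcut_level_fun : exists2 N : set R, countable N &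
  forall a, 0 < a <= 1 -> ~ N a -> fcut level_fun a = K a.
Proof.
pose B (ij : nat * nat) := [set y : 'rV[R]_m | edist y (rat_point R m ij.1) < ij.2.+1%:R^-1].
pose s ij := sup [set b | 0 < b <= 1 /\ (B ij `&` K b) !=set0].
exists (range s); first by apply: sub_countable (card_image_le s setT) _; exact: countableP.
move=> a a01 Na; have /andP[a0 a1] := a01.
rewrite fcut_gt0//; apply/seteqP; split=> x /=; last exact: level_fun_ge.
move=> /(le_level_funP _ a01) Kx; apply: contrapT => nK; apply: Na.
have /near_edistP[e e0 xe] : \forall y \near x, ~ K a y.
  by apply: open_nbhs_nbhs; split => //; rewrite openC; exact: Kclosed.
have e20 : 0 < e / 2 by rewrite divr_gt0.
have [j /= je] := filter_ex (near_infty_natSinv_lt (PosNum e20)).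
have j0 : 0 < j.+1%:R^-1 :> R by rewrite invr_gt0.
have [i xi] := exists_rat_point x j0.
(* The ball [B (i, j)] contains [x] and misses [K a]: it meets [K b] for all positive [b < a] and
   for no [b > a], so its last level is [a]. *)
exists (i, j) => //; set S := [set b | 0 < b <= 1 /\ (B (i, j) `&` K b) !=set0].
have ubS : ubound S a.
  move=> b [/andP[b0 b1] [y [By Kb]]]; rewrite leNgt; apply/negP => ab.
  apply: (xe y); last by apply: Kanti Kb => //; exact: ltW.
  rewrite /B/= in By; have := edist_triangle (rat_point R m i) x y.
  rewrite (edistC (rat_point R m i) y); move: (j.+1%:R^-1 : R) je xi By => *; lra.
have inS b : 0 < b < a -> S b.
  move=> b0a; have /andP[b0 ba] := b0a; split.
    by apply/andP; split; lra.
  by exists x; split; [exact: xi|exact: Kx].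
have a2 : 0 < a / 2 < a by apply/andP; split; lra.
have S0 : S !=set0 by exists (a / 2); exact: inS.
rewrite -[LHS]/(sup S); apply/le_anti/andP; split; first exact: ge_sup.
rewrite leNgt; apply/negP => sa.
have hS : has_sup S by split=> //; exists a.
have sgt : a / 2 <= sup S by apply: sup_upper_bound => //; exact: inS.
have : (sup S + a) / 2 <= sup S.
  by apply: sup_upper_bound => //; apply: inS; apply/andP; split; lra.
lra.
Qed.

End limit_fuzzy_set.

(** * Limit of a fast Cauchy sequence *)

Section completeness.
Context (R : realType) (m : nat) (p : R).
Hypothesis p1 : 1 <= p.
Variable v : nat -> 'rV[R]_m -> R.
Hypothesis FBv : forall n, FB (v n).
Hypothesis dpv : forall n, (dp p (v n) (v n.+1) <= (4^-1 ^+ n.+1)%:E)%E.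
Local Notation mu := (@lebesgue_measure R).

Let p0 : 0 < p. Proof. exact: lt_le_trans p1. Qed.
Let nv n : normal (v n). Proof. exact/FB_normal/FBv. Qed.

Let D : set R := `[0, 1]%classic.
Let mD : measurable D. Proof. exact: measurable_itv. Qed.
(** The weight [2^n] against gaps of order [4^-n] keeps the sum [G] integrable. Conversely, a finite
    [G a] bounds the [n]-th gap at level [a] by [(G a)^(1/p) / 2^n], so one function yields both
    convergence at almost every level and the rate in [dp]. *)
Let term n (a : R) : \bar R := (((2 ^+ n)%:E * hcut (v n) (v n.+1) a) `^ p)%E.
Let G (a : R) : \bar R := (\sum_(0 <= n <oo) term n a)%E.

Let term_ge0 n a : (0 <= term n a)%E. Proof. exact: poweR_ge0. Qed.

Let mterm n : measurable_fun D (term n).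
Proof.
apply: measurable_poweR_comp; apply: measurable_funeM.
exact: measurable_hcut.
Qed.

Let mG : measurable_fun D G.
Proof. by apply: ge0_emeasurable_sum => // n a _ _; exact: term_ge0. Qed.

Let G_ge0 a : (0 <= G a)%E.
Proof. by apply: nneseries_ge0 => n _ _; exact: term_ge0. Qed.

Let intG : (\int[mu]_(a in D) G a <= 1)%E.
Proof.
rewrite integral_nneseries//.
(* The [n]-th integral is compared with [1 / 2^(n+1)]. *)
apply: le_trans (@epsilon_trick0 R 1 xpredT ler01).
apply: lee_nneseries => [n _ _|n _]; first exact: integral_ge0.
have -> : (\int[mu]_(a in D) term n a =
    (2 ^+ n)%:E `^ p * \int[mu]_(a in D) (hcut (v n) (v n.+1) a `^ p))%E.
  rewrite -ge0_integralZl//; last 3 first.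
  - by apply: measurable_poweR_comp; exact: measurable_hcut.
  - by move=> a _; exact: poweR_ge0.
  - exact: poweR_ge0.
  apply: eq_integral => a; rewrite inE => /in01 a01; rewrite /term.
  by rewrite poweRM ?lee_fin ?exprn_ge0 ?hcut_ge0.
have q0 : 0 <= 4^-1 ^+ n.+1 :> R by rewrite exprn_ge0// invr_ge0.
have t0 : 0 <= 2 ^+ n :> R by rewrite exprn_ge0.
have H : (\int[mu]_(a in D) (hcut (v n) (v n.+1) a `^ p) <= (4^-1 ^+ n.+1)%:E `^ p)%E.
  by apply: (LpN_le_pow _ _ _ p0 _).1; rewrite ?lee_fin//; exact: dpv.
apply: (@le_trans _ _ ((2 ^+ n)%:E `^ p * (4^-1 ^+ n.+1)%:E `^ p)%E).
  by apply: lee_wpmul2l => //; exact: poweR_ge0.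
have t0' : (0 <= (2 ^+ n : R)%:E)%E by rewrite lee_fin.
have q0' : (0 <= (4^-1 ^+ n.+1 : R)%:E)%E by rewrite lee_fin.
rewrite -(poweRM p t0' q0') -EFinM poweR_EFin lee_fin natrX div1r.
have E : 2 ^+ n * 4^-1 ^+ n.+1 = (2 ^+ n.+1)^-1 * 2^-1 :> R.
  have -> : (4 : R) = 2 * 2 by rewrite -natrM.
  rewrite !exprVn exprMn !exprS; field.
  by rewrite expf_neq0.
have i1 : (2 ^+ n.+1)^-1 <= 1 :> R by rewrite invf_le1 ?exprn_gt0// exprn_ege1// ler1n.
have i0 : 0 < (2 ^+ n.+1)^-1 :> R by rewrite invr_gt0 exprn_gt0.
(* The factor [2^-1] is dropped; the rest is at most 1, so the exponent [p >= 1] can only decrease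
   it. *)
rewrite E; apply: (@le_trans _ _ ((2 ^+ n.+1)^-1 `^ p)).
  by apply: ge0_ler_powR; rewrite ?nnegrE ?(ltW p0) ?mulr_ge0 ?(ltW i0) ?invr_ge0//; lra.
rewrite -[leRHS]powRr1 ?(ltW i0)//.
by apply: ger_powR => //; rewrite i0.
Qed.

Let hcut_le_G n a : 0 <= a <= 1 -> G a \is a fin_num ->
  (hcut (v n) (v n.+1) a <= (fine (G a) `^ p^-1 / 2 ^+ n)%:E)%E.
Proof.
move=> a01 Gfin; have t0 : 0 < 2 ^+ n :> R by rewrite exprn_gt0.
have h0 : (0 <= hcut (v n) (v n.+1) a)%E by exact: hcut_ge0.
have tG : (term n a <= G a)%E.
  apply: le_trans (nneseries_lim_ge n.+1 (fun k _ _ => term_ge0 k a)).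
  by rewrite big_nat_recr//= leeDr// sume_ge0.
have : ((2 ^+ n)%:E * hcut (v n) (v n.+1) a <= (fine (G a) `^ p^-1)%:E)%E.
  rewrite -poweR_EFin fineK//.
  rewrite -[leLHS](poweRKV p0) ?mule_ge0 ?lee_fin ?(ltW t0)//.
  by apply: ge0_le_poweR; [rewrite invr_ge0 ltW|exact: poweR_ge0|exact: tG].
by rewrite -lee_pdivlMl// -EFinM mulrC.
Qed.

Let K a := set_lim (fun n => fcut (v n) a).

Let cut0 a : 0 <= a <= 1 -> forall n, fcut (v n) a !=set0.
Proof. by move=> a01 n; exact: fcut_nonempty. Qed.

Let Kanti a b : 0 < a -> a <= b -> b <= 1 -> K b `<=` K a.
Proof.
move=> a0 ab b1; apply: set_lim_anti => n; last by apply: fcut_anti => //; exact: ltW.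
by apply: cut0; apply/andP; split; lra.
Qed.

Let Kclosed a : 0 < a <= 1 -> closed (K a).
Proof.
by move=> /andP[a0 a1]; apply: closed_set_lim; apply: cut0; rewrite (ltW a0).
Qed.

Let Klim a : 0 <= a <= 1 -> G a \is a fin_num -> K a !=set0 /\ forall n,
  (hausdorff_dist (fcut (v n) a) (K a) <= (2 / 2 ^+ n * fine (G a) `^ p^-1)%:E)%E.
Proof.
move=> a01 Gfin; apply: hausdorff_set_lim_geometric.
- exact: powR_ge0.
- exact: cut0.
- by move=> n; exact: hcut_le_G.
Qed.

Let aeG : {ae mu, forall a, D a -> G a \is a fin_num}.
Proof.
apply: integrable_ae; first exact: measurable_itv.
apply/integrableP; split; first exact: mG.
under eq_integral do rewrite gee0_abs ?G_ge0//.
by apply: le_lt_trans intG _; rewrite ltry.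
Qed.

Let u := level_fun K.

Lemma normal_lim : normal u.
Proof.
have h0 : 0 < 2^-1 :> R by rewrite invr_gt0.
(* At a level [a] below [2^-1] with [G a] finite, [K a] is at finite distance from a bounded cut of
   [v 0]; hence it is compact, and it contains [K 2^-1]. *)
have [|a /andP[a0 a2] Ga] := ae_lebesgue_itv aeG h0.
  by move=> a; rewrite /D/= !in_itv/= => /andP[? ?]; apply/andP; split; lra.
have a01 : 0 <= a <= 1 by apply/andP; split; lra.
have [Ka0 Kdist] := Klim a01 Ga.
have [M M0 vM] := FB_bound (FBv 0).
pose c := 2 / 2 ^+ 0 * fine (G a) `^ p^-1.
apply: (normal_level_fun Kanti Kclosed (r := 2^-1) (C := K a)).
- apply: bounded_closed_compact; last by apply: Kclosed; rewrite a0; lra.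
  apply: (@bounded_set_edist _ _ _ (M + c + 1)) => x Kx.
  have := le_trans (dset_le_hausdorff x (cut0 a01 0) Ka0) (Kdist 0%N).
  rewrite (dset_eq0 Kx) subr0 lee_fin -/c => /(le_trans (ler_norm _)) xc.
  have [y vy xy] := dset_adherent x (cut0 a01 0) ltr01.
  have := edist_triangle y x 0; have := vM _ a01 y vy; lra.
- by apply/andP; split; lra.
- by apply: Kanti; lra.
- move=> b /andP[b0 b1].
  (* Above [b] there is a level with [G] finite, whose nonempty limit set is contained in [K b]. *)
  have [|c' /andP[bc c1] Gc] := ae_lebesgue_itv aeG b1.
    by move=> t; rewrite /D/= !in_itv/= => /andP[? ?]; apply/andP; split; lra.
  have c01 : 0 <= c' <= 1 by apply/andP; split; lra.
  have [[x Kx] _] := Klim c01 Gc; exists x.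
  by apply: Kanti Kx; lra.
Qed.

(** Off a null set (level 0, the exceptional levels of [fcut_level_fun], the levels with [G]
    infinite) the cut of [u] is [K a], within [2 / 2^n * (G a)^(1/p)] of that of [v n]. This bound
    has norm at most [2 / 2^n], as [G] has integral at most 1. *)
Lemma dp_lim n : (dp p (v n) u <= (2 / 2 ^+ n)%:E)%E.
Proof.
have [N cN NK] := fcut_level_fun Kanti Kclosed.
have c0 : 0 <= 2 / 2 ^+ n :> R by rewrite divr_ge0// exprn_ge0.
have aeF : Filter (almost_everywhere mu) by exact: ae_filter_ringOfSetsType.
have ae_countable (S : set R) : countable S -> {ae mu, forall a, ~ S a}.
  move=> cS; exists S; split.
  - by apply: countable_measurable => //; exact: measurable_set1.
  - exact: countable_lebesgue_measure0.
  - by move=> a /contrapT.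
have aeN : {ae mu, forall a, a != 0 /\ ~ N a}.
  apply: (@filterS2 _ _ aeF _ _ _ _ (ae_countable _ (countable1 0)) (ae_countable _ cN)) => a a0 Na.
  by split => //; apply/eqP.
pose g (a : R) : \bar R := ((2 / 2 ^+ n)%:E * G a `^ p^-1)%E.
have mg : measurable_fun D g.
  by apply: measurable_funeM; exact: measurable_poweR_comp.
apply: (@le_trans _ _ (LpN mu p D g)).
  rewrite dpE; apply: ae_LpN_le => //.
    by apply: measurable_hcut => //; exact: normal_lim.
  apply: (@filterS2 _ _ aeF _ _ _ _ aeG aeN) => a GD Na Da.
  have a01 := in01 Da; have Ga := GD Da.
  have [a_neq0 NNa] := Na.
  have a01' : 0 < a <= 1.
    by have /andP[a0 ->] := a01; rewrite lt_neqAle eq_sym a_neq0 a0.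
  rewrite hcut_ge0//=; last exact: normal_lim.
  rewrite /hcut (NK a a01' NNa).
  apply: le_trans ((Klim a01 Ga).2 n) _.
  by rewrite /g -[in leRHS](fineK Ga) poweR_EFin -EFinM.
apply/LpN_le_pow => //.
have -> : (\int[mu]_(a in D) (g a `^ p) = (2 / 2 ^+ n)%:E `^ p * \int[mu]_(a in D) G a)%E.
  rewrite -ge0_integralZl//; last exact: poweR_ge0.
  apply: eq_integral => a _; rewrite /g poweRM ?poweR_ge0 ?lee_fin//.
  by rewrite poweRVK.
rewrite -[leRHS]mule1; apply: lee_wpmul2l => //; exact: poweR_ge0.
Qed.

(** Boundedness of the 0-cut need not survive the limit; the triangle inequality through [v 0] gives
    membership in [FBp p]. *)
Lemma FBp_complete : exists2 w, FBp p w & forall n, (dp p (v n) w <= (2 / 2 ^+ n)%:E)%E.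
Proof.
exists u; last exact: dp_lim.
apply/FBpE; split.
- exact: fuzzy_level_fun.
- exact: normal_lim.
- exact: upper_semicontinuous_level_fun.
- apply: le_lt_trans (dp_triangle p1 normal_lim (nv 0) (normal_hat0 R m)) _.
  have /FBpE[_ _ _ vy] := sub_FB_FBp p1 (FBv 0).
  apply: lte_add_pinfty vy; rewrite dpC.
  by apply: le_lt_trans (dp_lim 0) _; rewrite ltry.
Qed.

End completeness.

(** * From an ultrafilter to its limit *)

Section compactness_criterion.
Context (R : realType) (m : nat) (p : R) (U : set ('rV[R]_m -> R)).
Hypothesis p1 : 1 <= p.
Hypothesis UFB : U `<=` @FB R m.

Lemma compact_of_bounded_equi_closed : unif_p_mean_bounded p U ->
  p_mean_equi_left_continuous p U ->
  closure (in_dp_space p (@FBp R m p) U) = in_dp_space p (@FBp R m p) U ->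
  compact (in_dp_space p (@FB R m) U).
Proof.
move=> Ubd Ueq Ucl; rewrite compact_ultra => F FU FUU.
have UN u : U u -> normal u by move=> /UFB/FB_normal.
pose q n : R := 4^-1 ^+ n.+1.
have q0 n : 0 < q n by rewrite exprn_gt0// invr_gt0.
have /choice[A_ AF] := fun n => ultra_dp_cauchy p1 FU FUU UN Ubd Ueq (q0 n).
(* With [v_ n] in both [A_ n] and [A_ n.+1], consecutive terms share the small set [A_ n.+1], and
   the sets [A_ n] need not decrease. *)
have /choice[v_ vA] : forall n, exists v, A_ n v /\ A_ n.+1 v.
  move=> n; have [An _ _] := AF n; have [AnS _ _] := AF n.+1.
  by have [v [? ?]] := filter_ex (filterI An AnS); exists v.
have dpv n : (dp p (sval (v_ n)) (sval (v_ n.+1)) <= (4^-1 ^+ n.+1)%:E)%E.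
  have [_ _ diam] := AF n.+1.
  apply: le_trans (diam _ _ (vA n).2 (vA n.+1).1) _; rewrite lee_fin /q.
  by rewrite [leLHS]exprS ler_piMl ?exprn_ge0 ?invr_ge0// invf_le1// ler1n.
have [w FBw vw] := FBp_complete p1 (fun n => svalP (v_ n)) dpv.
have nw := FBp_normal FBw.
have Uv n : U (sval (v_ n)) by have [_ AU _] := AF n; exact: AU (vA n).1.
have near_half (r : R) : 0 < r -> \forall n \near \oo, 2 / 2 ^+ n < r.
  move=> r0; have r20 : 0 < r / 2 by rewrite divr_gt0.
  have := near_infty_natSinv_expn_lt (PosNum r20); apply: filterS => n /=; lra.
(* The limit is known only to lie in [FBp p]; closedness there returns it to [U], hence to [FB],
   where the ultrafilter has to converge. *)
have Uw : U w.
  have clw : closure (in_dp_space p (@FBp R m p) U) (exist _ w FBw).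
    move=> B /nbhs_dp_ball[r r0 rB].
    have [n nr] := filter_ex (near_half r r0).
    exists (exist _ (sval (v_ n)) (sub_FB_FBp p1 (svalP (v_ n)))); split; first exact: Uv.
    apply: rB; rewrite /dp_ball/= dpC.
    by apply: le_lt_trans (vw n) _; rewrite lte_fin.
  by rewrite Ucl in clw.
exists (exist _ w (UFB Uw)); split; first exact: Uw.
move=> B /nbhs_dp_ball[r r0 rB].
have r2 : 0 < r / 2 by rewrite divr_gt0.
have [n nr] := filter_ex (near_half _ r2).
have [An AU diam] := AF n.
apply: filterS An => x Ax; apply: rB; rewrite /dp_ball/= dpC.
apply: le_lt_trans (dp_triangle p1 (UN _ (AU _ Ax)) (UN _ (Uv n)) nw) _.
apply: le_lt_trans (leeD (diam _ _ Ax (vA n).1) (vw n)) _.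
rewrite -EFinD lte_fin; suff : q n <= 2 / 2 ^+ n by lra.
rewrite /q exprS -exprVn; apply: ler_pM; rewrite ?exprn_ge0 ?invr_ge0//; first by lra.
by rewrite lerXn2r ?nnegrE ?invr_ge0// lef_pV2 ?posrE// ler_nat.
Qed.

End compactness_criterion.

Theorem theorem5p6 (R : realType) (m : nat) (p : R) (U : set ('rV[R]_m -> R))
    (hm : (1 <= m)%N) (hp : 1 <= p) (hU : U `<=` @FB R m) :
  compact (in_dp_space p (@FB R m) U) <->
  [/\ unif_p_mean_bounded p U,
      p_mean_equi_left_continuous p U &
      closure (in_dp_space p (@FBp R m p) U) = in_dp_space p (@FBp R m p) U].
Proof.
split=> [Uco|[Ubd Ueq Ucl]]; last exact: compact_of_bounded_equi_closed.
split.
- exact: compact_unif_p_mean_bounded.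
- exact: compact_equi_left_continuous.
- exact: compact_closed_dp.
Qed.
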